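(* Let $d\ge2$, let $f\in\mathcal{E}'_{\rm rad}(\mathbb{R}^d)$ be a radial compactly supported distribution on $\mathbb{R}^d$ and let $\kappa\in\mathbb{C}\setminus\{0\}$. Then for every $\xi\in\mathbb{R}^d$, $$\mathcal{F}f(\xi)=(2\pi)^d\sum_{\ell=0}^\infty\sigma_\ell[f,\kappa]\,Z_{\ell,d}\Big(1-\frac{|\xi|^2}{2\kappa}\Big),$$ where the series is absolutely convergent.
   Context: $\nu_d=(d-2)/2$; $\varphi_\ell(z)=J_{\ell+\nu_d}(z)/z^{\nu_d}$ (entire; $J_\nu$ the Bessel function of the first kind; $\varphi_\ell(z)^2$ is an entire function of $z^2$). For $f\in\mathcal{E}'_{\rm rad}(\mathbb{R}^d)$: $\sigma_\ell[f,\kappa]=\frac{1}{|\mathbb{S}^{d-1}|}\langle f,\varphi_\ell(\sqrt\kappa|\cdot|)^2\rangle_{\mathcal{E}'\times C^\infty}$ and $\mathcal{F}f(\xi)=\langle f,e^{-i\xi\cdot x}\rangle_{\mathcal{E}'\times C^\infty}$. $Z_{\ell,d}$ is the polynomial (evaluated also at complex arguments) such that $u\mapsto\int_{\mathbb{S}^{d-1}}Z_{\ell,d}(x\cdot y)u(y)\,dy$ is the orthogonal projection of $L^2(\mathbb{S}^{d-1})$ onto the space $\mathfrak{H}^d_\ell$ of spherical harmonics of degree $\ell$. Explicitly, $Z_{\ell,d}=\frac{N_{\ell,d}}{|\mathbb{S}^{d-1}|}P_{\ell,d}$, where $N_{\ell,d}=\dim\mathfrak{H}^d_\ell$ and $P_{\ell,d}(t)=(-1)^\ell\frac{\Gamma(\frac{d-1}{2})}{2^\ell\Gamma(\ell+\frac{d-1}{2})}(1-t^2)^{-\frac{d-3}{2}}\frac{d^\ell}{dt^\ell}(1-t^2)^{\ell+\frac{d-3}{2}}$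 is the generalized Legendre polynomial. *)

(* Defs.v *)
From HB Require Import structures.
From mathcomp Require Import all_boot all_order all_algebra.
From mathcomp Require mpoly.

Set Implicit Arguments.
Unset Strict Implicit.
Unset Printing Implicit Defensive.

(* The notations of mpoly clash with those of MathComp-Analysis, so mpoly is
   imported in this module only. *)
Module Harmonic.
Import mpoly GRing.Theory.
Local Open Scope ring_scope.

Section Harmonic.
Variables (K : fieldType) (n l : nat).

Definition laplacian (p : {mpoly K[n.+1]}) : {mpoly K[n.+1]} :=
  \sum_(i < n.+1) mderiv i (mderiv i p).

(* The Laplacian from forms of degree l to forms of degree l - 2 (it is 0 when
   l < 2, so the truncation of l.-2 is harmless). *)
Definition laplacian_homog (p : dhomog n.+1 K l) : dhomog n.+1 K l.-2 :=
  indhomog l.-2 (laplacian p).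

Definition harmonic : {vspace dhomog n.+1 K l} := lker (linfun laplacian_homog).

End Harmonic.
End Harmonic.

From mathcomp Require Import complex.
From mathcomp Require Import all_classical all_reals all_analysis.

Import Order.TTheory GRing.Theory Num.Theory.
Import numFieldNormedType.Exports.

Local Open Scope classical_set_scope.
Local Open Scope ring_scope.
Local Open Scope complex_scope.

Section Distributions.
Variables (R : realType) (d : nat).

Implicit Types (g : 'rV[R]_d -> R) (phi psi : 'rV[R]_d -> R[i]).

Definition partial (i : 'I_d) g : 'rV[R]_d -> R :=
  fun x => 'D_(delta_mx 0 i) g x.

Definition partials (s : seq 'I_d) g : 'rV[R]_d -> R := foldr partial g s.

Definition real_smooth g : Prop :=
  forall s : seq 'I_d, continuous (partials s g) /\
    forall (i : 'I_d) (x : 'rV[R]_d), derivable (partials s g) x (delta_mx 0 i).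

Definition smooth phi : Prop :=
  real_smooth (fun x => complex.Re (phi x)) /\ real_smooth (fun x => complex.Im (phi x)).

Definition cpartials (s : seq 'I_d) phi : 'rV[R]_d -> R[i] :=
  fun x => partials s (fun y => complex.Re (phi y)) x +i*
           partials s (fun y => complex.Im (phi y)) x.

(* E'(R^d) as the topological dual of C^oo(R^d), whose topology is that of
   uniform convergence of all partial derivatives on compact sets.  The pairing
   is a total function; its values outside C^oo(R^d) are unconstrained. *)
Record compact_distribution := CompactDistribution {
  pairing :> ('rV[R]_d -> R[i]) -> R[i];
  pairing_linear : forall (a : R[i]) phi psi, smooth phi -> smooth psi ->
    pairing (fun x => a * phi x + psi x) = a * pairing phi + pairing psi;
  pairing_continuous : forall phi, smooth phi -> forall e : R, 0 < e ->
    exists (K : set 'rV[R]_d) (m : nat) (delta : R),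
      [/\ compact K, 0 < delta &
        forall psi, smooth psi ->
          (forall s : seq 'I_d, (size s <= m)%N -> forall x, K x ->
             `|cpartials s psi x - cpartials s phi x| < delta%:C) ->
          `|pairing psi - pairing phi| < e%:C] }.

Definition radial (f : compact_distribution) : Prop :=
  forall A : 'M[R]_d, A *m A^T = 1%:M ->
  forall phi, smooth phi -> f (fun x => phi (x *m A)) = f phi.

Definition dot (x y : 'rV[R]_d) : R := \sum_(i < d) x 0 i * y 0 i.

(* The norm `|x| of 'rV[R]_d is the sup norm. *)
Definition enorm (x : 'rV[R]_d) : R := Num.sqrt (dot x x).

Definition fourier (f : compact_distribution) (xi : 'rV[R]_d) : R[i] :=
  f (fun x => cos (dot xi x) -i* sin (dot xi x)).

End Distributions.

Section SpecialFunctions.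
Variable R : realType.

(* Used for x > 0 only. *)
Definition Gamma (x : R) : R :=
  \int[lebesgue_measure]_(t in `]0, +oo[) (t `^ (x - 1) * expR (- t)).

Definition carg (z : R[i]) : R :=
  let theta := acos (complex.Re z / complex.Re `|z|) in if 0 <= complex.Im z then theta else - theta.

(* Principal branch, argument in ]-pi, pi]. *)
Definition cpowr (z : R[i]) (a : R) : R[i] :=
  ((complex.Re `|z|) `^ a)%:C * (cos (a * carg z) +i* sin (a * carg z)).

Definition BesselJ (nu : R) (z : R[i]) : R[i] :=
  let c (m : nat) : R[i]^o :=
    ((-1) ^+ m / (m`!%:R * Gamma (m%:R + nu + 1)))%:C * (z / 2) ^+ m.*2 in
  cpowr (z / 2) nu * limn (series c).

Section Dimension.
Variable d : nat.

Definition nu_ : R := (d%:R - 2) / 2.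

(* The singularity of the quotient at 0 is removable.  For z != 0 the values of
   J_(l + nu)(z) and z^nu on a common branch have a branch-independent
   quotient. *)
Definition besselphi (l : nat) (z : R[i]) : R[i] :=
  let q (w : R[i]^o) : R[i]^o := BesselJ (l%:R + nu_) w / cpowr w nu_ in
  if z == 0 then lim (q w @[w --> (0 : R[i]^o)^']) else q z.

(* The area 2 pi^(d/2) / Gamma(d/2) of the unit sphere of R^d. *)
Definition sphere_area : R := 2 * pi `^ (d%:R / 2) / Gamma (d%:R / 2).

(* Spherical harmonics of degree l are the restrictions to the sphere of the
   harmonic forms of degree l; restriction is injective by homogeneity.
   Here d = d.-1.+1 since d > 0. *)
Definition harmonic_dim (l : nat) : nat := \dim (Harmonic.harmonic R[i] d.-1 l).

Definition rodrigues (l : nat) (t : R) : R :=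
  (-1) ^+ l * (Gamma ((d%:R - 1) / 2) /
    (2 ^+ l * Gamma (l%:R + (d%:R - 1) / 2))) *
  (1 - t ^+ 2) `^ (- ((d%:R - 3) / 2)) *
  derive1n l (fun s : R => (1 - s ^+ 2) `^ (l%:R + (d%:R - 3) / 2)) t.

(* The polynomial given on ]-1, 1[ by the Rodrigues formula. *)
Definition legendre (l : nat) : {poly R} :=
  xget 0 [set p : {poly R} | forall t, -1 < t < 1 -> p.[t] = rodrigues l t].

Definition zonal (l : nat) (z : R[i]) : R[i] :=
  (map_poly (real_complex R)
     (((harmonic_dim l)%:R / sphere_area) *: legendre l)).[z].

End Dimension.

Definition sigma (d : nat) (f : compact_distribution R d) (kappa : R[i])
    (l : nat) : R[i] :=
  (sphere_area d)^-1%:C *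
  f (fun x => besselphi d l (sqrtC kappa * (enorm x)%:C) ^+ 2).

End SpecialFunctions.

(* Main.v *)
(** Both sides only involve the moments mu_m = <f, |x|^(2m)>.  Power series with
    entire coefficients in a smooth function q converge in C^oo, so that f may
    be applied to them term by term.  On the one hand, applying radiality to
    orthogonal reflections expresses <f, (xi.x)^n> by mu_(n/2) |xi|^n (and by 0
    for odd n), which expands the Fourier transform.  On the other hand,
    phi_l(z)^2 is a power series in z^2 starting at z^(2l), so sigma_l Z_l is a
    series over m >= l of multiples of mu_m.  The resulting double series is
    triangular with geometrically decreasing columns, hence it may be summed by
    columns.  With w = |xi|^2 / (2 kappa), the column of index m is a polynomial
    of degree m in w; its coefficients are alternating sums over l that
    telescope to 0 in degrees below m, and its leading term is the m-th term of
    the Fourier expansion. *)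

Require Import Defs.
From HB Require Import structures.
From mathcomp Require Import all_boot all_order all_algebra.
From mathcomp Require Import zify.
From mathcomp Require mpoly.

Set Implicit Arguments.
Unset Strict Implicit.
Unset Printing Implicit Defensive.

(** * Dimension of the space of harmonic forms *)

Module HarmonicDim.
Import mpoly GRing.Theory.
Import Harmonic.
Local Open Scope ring_scope.

Section HarmonicDim.
Variables (K : fieldType) (n : nat).

(** The growth of the moments is read off from convergence: for every entire series with
    coefficients c_m, the terms c_m mu_m are bounded since [f] can be applied termwise. Taking c_m =
    P^m / m! with P large absorbs the growth of Z_l (1 - w), which is exponential in l; where the
    double series is nonzero one has l <= m, so this becomes growth in m. The ratio 1/4 in the
    bounds leaves room for the at most m + 1 <= 2^m entries of a column, whose sum then still
    decreases like 2^-m. The cancellation inside a column depends on the exact dimension of the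
    harmonic forms, which rank-nullity gives once the Laplacian is known to be onto. Legendre
    polynomials are expanded about t = 1, so that Z_l (1 - w) is a polynomial in w. Throughout, [D]
    stands for d - 2 and h for d / 2. *)

Lemma laplacian_linear : linear (@laplacian K n).
Proof.
move=> a p q; rewrite /laplacian scaler_sumr -big_split /=.
by apply: eq_bigr => i _; rewrite !linearP.
Qed.

HB.instance Definition _ := GRing.isLinear.Build K {mpoly K[n.+1]}
  {mpoly K[n.+1]} _ (@laplacian K n) laplacian_linear.

Lemma laplacian_monomial (m : 'X_{1..n.+1}) :
  laplacian 'X_[K, m] =
  \sum_i ((m i) * (m i).-1)%:R *: 'X_[(m - U_(i) - U_(i))%MM].
Proof.
apply: eq_bigr => i _; rewrite mderivX linearZ /= mderivX scalerA -natrM.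
by rewrite mnmBE mnm1E eqxx subn1.
Qed.

Lemma mnm_subU2K (m : 'X_{1..n.+1}) (i : 'I_n.+1) : (1 < m i)%N ->
  (m - U_(i) - U_(i) + U_(i) + U_(i))%MM = m.
Proof.
move=> mi; apply/mnmP => j; rewrite !mnmDE !mnmBE !mnm1E.
case: eqVneq => [<-|_] /=; last by rewrite !subn0 !addn0.
by rewrite !subn1 !addn1; case: (m i) mi => [|[|]].
Qed.

Lemma mdeg_subU2 (m : 'X_{1..n.+1}) (i : 'I_n.+1) : (1 < m i)%N ->
  mdeg (m - U_(i) - U_(i))%MM = (mdeg m).-2.
Proof. by move/mnm_subU2K=> e; rewrite -[in RHS]e !mdegD !mdeg1 !addn1. Qed.

(** When [m i <= 1] the truncated subtraction of exponents may give the wrong degree, but then the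
    coefficient is 0. *)
Lemma laplacian_monomial_homog l (m : 'X_{1..n.+1}) (i : 'I_n.+1) :
  mdeg m = l ->
  ((m i) * (m i).-1)%:R *: 'X_[K, (m - U_(i) - U_(i))%MM] \is l.-2.-homog.
Proof.
move=> ml; case: (ltnP 1 (m i)) => mi; last first.
  rewrite (_ : (_ * _)%N = 0%N) ?scale0r ?dhomog0 //.
  by case: (m i) mi => [|[|]].
apply/dhomogZ; rewrite dhomogX.
by apply/eqP; rewrite -ml; apply: mdeg_subU2.
Qed.

Lemma laplacian_is_homog l (p : {mpoly K[n.+1]}) :
  p \is l.-homog -> laplacian p \is l.-2.-homog.
Proof.
move=> /dhomogP hp; rewrite (mpolyE p) linear_sum /= big_seq.
apply: rpred_sum => m mp; rewrite linearZ /=; apply/dhomogZ.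
rewrite laplacian_monomial; apply: rpred_sum => i _.
exact/laplacian_monomial_homog/hp.
Qed.

Lemma laplacian_homogE l (p : dhomog n.+1 K l) :
  val (laplacian_homog p) = laplacian (val p).
Proof.
by rewrite /laplacian_homog /indhomog insubdK //; apply/laplacian_is_homog/dhomog_is_dhomog.
Qed.

Lemma laplacian_homog_linear l : linear (@laplacian_homog K n l).
Proof.
by move=> a p q; apply/val_inj; rewrite /= !laplacian_homogE linearP.
Qed.

HB.instance Definition _ l := GRing.isLinear.Build K (dhomog n.+1 K l)
  (dhomog n.+1 K l.-2) _ (@laplacian_homog K n l) (@laplacian_homog_linear l).

(* Modulo the image of the Laplacian, a monomial is a combination of monomials
   of the same degree with a larger exponent of the first variable. *)
Lemma laplacian_monomial_onto l (m : 'X_{1..n.+1}) :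
  [pchar K] =i pred0 -> mdeg m = l ->
  exists2 p, p \is l.+2.-homog & laplacian p = 'X_[K, m].
Proof.
move=> charK; have [k] := ubnP (l - m ord0); elim: k m => // k IH m lk ml.
(* The Laplacian of the monomial [m2] contains [m] with a coefficient that is nonzero in
   characteristic 0. In its other terms the first variable has exponent [(m ord0).+2], so the
   induction hypothesis provides preimages for them. *)
set m2 := (m + U_(ord0) + U_(ord0))%MM.
have m2l : mdeg m2 = l.+2 by rewrite /m2 !mdegD !mdeg1 ml !addn1.
have m20 : m2 ord0 = (m ord0).+2 by rewrite /m2 !mnmDE !mnm1E eqxx !addn1.
have m2m : (m2 - U_(ord0) - U_(ord0))%MM = m by rewrite /m2 !addmK.
pose r := \sum_(i | i != ord0)
   ((m2 i) * (m2 i).-1)%:R *: 'X_[K, (m2 - U_(i) - U_(i))%MM].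
have [q qh qr] : exists2 q, q \is l.+2.-homog & laplacian q = r.
  rewrite /r; elim/big_ind: _.
  - by exists 0; rewrite ?dhomog0 ?linear0.
  - move=> x y [p ph <-] [q qh <-]; exists (p + q); first exact/dhomogD.
    by rewrite linearD.
  move=> i i0; case: (ltnP 1 (m2 i)) => mi; last first.
    exists 0; rewrite ?dhomog0 // linear0 (_ : (_ * _)%N = 0%N) ?scale0r //.
    by case: (m2 i) mi => [|[|]].
  have ml' : mdeg (m2 - U_(i) - U_(i))%MM = l by rewrite mdeg_subU2 // m2l.
  have e0 : (m2 - U_(i) - U_(i))%MM ord0 = (m ord0).+2.
    by rewrite !mnmBE !mnm1E (negbTE i0) !subn0 m20.
  have [|//|p ph pE] := IH (m2 - U_(i) - U_(i))%MM.
    rewrite e0; have : ((m ord0).+2 <= l)%N.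
      by rewrite -ml' -e0 mdegE (bigD1 ord0) //= leq_addr.
    by move: lk => /[swap]; lia.
  exists (((m2 i) * (m2 i).-1)%:R *: p); first exact/dhomogZ.
  by rewrite linearZ /= pE.
have c0 : ((m ord0).+2 * (m ord0).+1)%:R != 0 :> K by have /pcharf0P-> := charK.
exists (((m ord0).+2 * (m ord0).+1)%:R^-1 *: ('X_[m2] - q)).
  by apply/dhomogZ/rpredB => //; rewrite dhomogX; apply/eqP.
rewrite linearZ linearB /= qr laplacian_monomial (bigD1 ord0) //=.
by rewrite -/r addrK m20 m2m scalerA /= mulVf // scale1r.
Qed.

Lemma laplacian_onto l (q : {mpoly K[n.+1]}) :
  [pchar K] =i pred0 -> q \is l.-homog ->
  exists2 p, p \is l.+2.-homog & laplacian p = q.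
Proof.
move=> charK /dhomogP qh; rewrite (mpolyE q) big_seq; elim/big_ind: _.
- by exists 0; rewrite ?dhomog0 ?linear0.
- move=> x y [p ph <-] [p' ph' <-]; exists (p + p'); first exact/dhomogD.
  by rewrite linearD.
move=> m /qh /(laplacian_monomial_onto charK) [p ph pE].
exists (q@_m *: p); first exact/dhomogZ.
by rewrite linearZ /= pE.
Qed.

Lemma laplacian_eq0 l (p : dhomog n.+1 K l) : (l <= 1)%N ->
  laplacian (val p) = 0.
Proof.
move=> l1; have /dhomogP hp := dhomog_is_dhomog p.
rewrite (mpolyE (val p)) linear_sum /= big_seq big1 // => m /hp ml.
rewrite linearZ /= laplacian_monomial big1 ?scaler0 // => i _.
have : (m i <= 1)%N.
  by apply: leq_trans l1; rewrite -ml [X in (_ <= X)%N]mdegE (bigD1 i) //= leq_addr.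
by case: (m i) => [|[|]] // _; rewrite scale0r.
Qed.

(** Rank-nullity: the forms of degree k have dimension ['C(k + n, n)], and the image of the
    Laplacian is everything for [l >= 2] but 0 for [l <= 1]. The factor [(1 < l)] separates the two
    cases, as [l.-2] is 0 in the second. *)
Lemma dim_harmonic l : [pchar K] =i pred0 ->
  (\dim (harmonic K n l) + 'C(l.-2 + n, n) * (1 < l) = 'C(l + n, n))%N.
Proof.
move=> charK.
have dimh k : dim (dhomog n.+1 K k) = 'C(k + n, n).
  by rewrite /dim /= -bin_sub ?leq_addr // addKn.
have := limg_ker_dim (linfun (@laplacian_homog K n l)) fullv.
rewrite capfv dimvf dimh => <-; congr addn.
case: (ltnP 1 l) => [|l1]; last first.
  rewrite muln0; apply/esym/eqP; rewrite dimv_eq0; apply/eqP/vspaceP => v.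
  rewrite memv0; apply/memv_imgP/eqP => [[p _ ->]|->]; last first.
    by exists 0; rewrite ?mem0v ?linear0.
  by rewrite lfunE; apply/val_inj; rewrite [LHS]laplacian_homogE laplacian_eq0.
case: l => [|[|l]] // _; rewrite muln1.
rewrite /= -(dimh l) -dimvf; congr (\dim _); apply/esym/vspaceP => q; rewrite memvf.
have [p ph pE] := laplacian_onto charK (dhomog_is_dhomog q).
apply/memv_imgP; exists (DHomog ph); rewrite ?memvf // lfunE.
by apply/val_inj; rewrite [RHS]laplacian_homogE pE.
Qed.
End HarmonicDim.
End HarmonicDim.

From mathcomp Require Import complex ring lra.
From mathcomp Require Import all_classical all_reals all_analysis measurable_realfun.

Import Order.TTheory GRing.Theory Num.Theory.
Import numFieldNormedType.Exports.

Local Open Scope classical_set_scope.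
Local Open Scope ring_scope.
Local Open Scope complex_scope.

(** * Smooth functions *)

Section Smooth.
Variables (R : realType) (d : nat).
Local Notation V := 'rV[R]_d.
Implicit Types (g h q : V -> R).

Lemma partials_rcons (s : seq 'I_d) (i : 'I_d) g :
  partials (rcons s i) g = partials s (partial i g).
Proof. by rewrite /partials foldr_rcons. Qed.

Lemma real_smooth_partial (i : 'I_d) g : real_smooth g -> real_smooth (partial i g).
Proof. by move=> sg s; rewrite -partials_rcons; exact: sg. Qed.

Lemma real_smooth_continuous g : real_smooth g -> continuous g.
Proof. by move=> /(_ [::]) []. Qed.

Lemma real_smooth_derivable g (i : 'I_d) (x : V) :
  real_smooth g -> derivable g x (delta_mx 0 i).
Proof. by move=> /(_ [::]) []. Qed.

(** A coinduction principle: stability of a class under first partial derivatives replaces formulas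
    for the iterated ones. *)
Lemma real_smooth_class (C : set (V -> R)) :
  (forall g, C g -> [/\ continuous g, (forall i x, derivable g x (delta_mx 0 i)) &
    forall i, C (partial i g)]) ->
  forall g, C g -> real_smooth g.
Proof.
move=> HC g Cg s; have : C (partials s g).
  by elim: s => //= i s /HC[].
by move=> /HC[].
Qed.

Lemma partial_cst (i : 'I_d) (a : R) : partial i (fun=> a) = fun=> 0.
Proof. by apply/funext => x; exact: derive_cst. Qed.

Lemma real_smooth_cst (a : R) : real_smooth (fun _ : V => a).
Proof.
apply: (@real_smooth_class [set g | exists b, g = fun=> b]); last by exists a.
move=> _ [b ->]; split; first exact: cst_continuous.
- by move=> i x; exact: derivable_cst.
- by move=> i; exists 0; rewrite partial_cst.
Qed.

Lemma partialM (i : 'I_d) g h : real_smooth g -> real_smooth h ->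
  partial i (fun x => g x * h x) =
  fun x => partial i g x * h x + g x * partial i h x.
Proof.
move=> sg sh; apply/funext => x; rewrite /partial.
rewrite -[LHS]/('D_(delta_mx 0 i) (g * h) x) deriveM; try exact: real_smooth_derivable.
by rewrite addrC /GRing.scale/= [X in X + _]mulrC.
Qed.

(* Unlike the products of two smooth functions, their sums are stable under
   partial derivatives. *)
Inductive sumprod : (V -> R) -> Prop :=
| SumprodM g h : real_smooth g -> real_smooth h -> sumprod (fun x => g x * h x)
| SumprodD g h : sumprod g -> sumprod h -> sumprod (fun x => g x + h x).

Lemma sumprod_smooth g : sumprod g -> real_smooth g.
Proof.
apply: real_smooth_class => {}g.
elim=> {g} [g h sg sh|g h _ [cg dg Cg] _ [ch dh Ch]].
  split=> [x|i x|i].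
  - have [cg _] := sg [::]; have [ch _] := sh [::].
    exact: (@continuousM R V g h x (cg x) (ch x)).
  - by apply: derivableM; exact: real_smooth_derivable.
  - rewrite (partialM i sg sh); apply: SumprodD.
      exact: (SumprodM (real_smooth_partial i sg) sh).
    exact: (SumprodM sg (real_smooth_partial i sh)).
split=> [x|i x|i].
- exact: (@continuousD R _ V g h x (cg x) (ch x)).
- exact: derivableD.
- rewrite (_ : partial i _ = fun x => partial i g x + partial i h x).
    exact: SumprodD.
  by apply/funext => x; rewrite /partial -deriveD.
Qed.

Lemma real_smoothM g h : real_smooth g -> real_smooth h ->
  real_smooth (fun x => g x * h x).
Proof. by move=> sg sh; apply: sumprod_smooth; exact: SumprodM. Qed.

Lemma real_smoothD g h : real_smooth g -> real_smooth h ->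
  real_smooth (fun x => g x + h x).
Proof.
move=> sg sh.
rewrite (_ : (fun x => _) = fun x => g x * 1 + h x * 1); last first.
  by apply/funext => x; rewrite !mulr1.
have s1 := real_smooth_cst 1.
exact: (sumprod_smooth (SumprodD (SumprodM sg s1) (SumprodM sh s1))).
Qed.

Lemma real_smooth_sum (I : Type) (r : seq I) (P : pred I) (F : I -> V -> R) :
  (forall i, real_smooth (F i)) -> real_smooth (fun x => \sum_(i <- r | P i) F i x).
Proof.
move=> sF; elim: r => [|i r IH].
  rewrite (_ : (fun x => _) = fun=> 0); first exact: real_smooth_cst.
  by apply/funext => x; rewrite big_nil.
rewrite (_ : (fun x => _) = fun x => (if P i then F i x else 0)
  + \sum_(i <- r | P i) F i x); last first.
  by apply/funext => x; rewrite big_cons; case: ifP => // _; rewrite add0r.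
apply: (real_smoothD _ IH).
by case: (P i); [exact: sF|exact: real_smooth_cst].
Qed.

Lemma real_smoothX g n : real_smooth g -> real_smooth (fun x => g x ^+ n).
Proof.
move=> sg; elim: n => [|n IH]; first exact: real_smooth_cst.
rewrite (_ : (fun x => _) = fun x => g x * g x ^+ n); last first.
  by apply/funext => x; rewrite exprS.
exact: real_smoothM.
Qed.

Lemma is_derive_coord (x v : V) (j : 'I_d) :
  is_derive x v (fun y : V => y 0 j : R) (v 0 j).
Proof.
apply: DeriveDef; first exact/diff_derivable/differentiable_coord.
apply: cvg_lim => //; apply: cvg_near_cst.
apply: filterS (nbhs_dnbhs_neq (0 : R)) => h h0.
by rewrite /= !mxE addrK; exact: mulKf.
Qed.

Lemma real_smooth_coord (j : 'I_d) : real_smooth (fun x : V => x 0 j).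
Proof.
apply: (@real_smooth_class [set g | g = (fun x : V => x 0 j) \/ exists b, g = fun=> b]); last by left.
move=> _ [->|[b ->]]; split.
- by move=> x; exact: coord_continuous.
- by move=> i x; case: (is_derive_coord x (delta_mx 0 i) j).
- move=> i; right; exists ((delta_mx 0 i : V) 0 j); apply/funext => x.
  exact: (@derive_val _ _ _ _ _ _ _ (is_derive_coord _ _ _)).
- exact: cst_continuous.
- by move=> i x; exact: derivable_cst.
- by move=> i; right; exists 0; rewrite partial_cst.
Qed.

Lemma real_smooth_dot (xi : V) : real_smooth (dot xi).
Proof.
apply: real_smooth_sum => i; apply: real_smoothM; first exact: real_smooth_cst.
exact: real_smooth_coord.
Qed.

Lemma real_smooth_dotxx : real_smooth (fun x : V => dot x x).
Proof.
by apply: real_smooth_sum => i; apply: real_smoothM; exact: real_smooth_coord.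
Qed.

(** [D j] is the j-th derivative of [D 0]; the whole sequence is carried along because iterated
    partial derivatives of [D 0 \o q] involve all of its members. *)
Definition derivative_tower (D : nat -> R -> R) :=
  forall j (t : R), is_derive t (1 : R) (D j) (D j.+1 t).

(** Only a directional derivative of [q] is at hand, not a Fréchet derivative. Restriction to the
    line through [x] along [v] reduces the claim to the chain rule in one variable. *)
Lemma is_derive_comp_line (D D' : R -> R) q (x v : V) :
  (forall t : R, is_derive t (1 : R) D (D' t)) -> derivable q x v ->
  is_derive x v (D \o q) (D' (q x) * 'D_v q x).
Proof.
move=> dD dq.
pose l (h : R) := q (h *: v + x).
have dl : is_derive (0 : R) (1 : R) l ('D_v q x).
  have dl : derivable l 0 1 := (derivable1P q x v).1 dq.
  apply: DeriveDef => //; rewrite -derive1E /derive1 /derive /l.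
  by under eq_fun do rewrite addr0 scale0r add0r.
have l0 : l 0 = q x by rewrite /l scale0r add0r.
have dc : is_derive (0 : R) (1 : R) (D \o l) (D' (q x) * 'D_v q x).
  rewrite -l0; exact: (@is_derive1_comp _ D l 0 _ _ (dD (l 0)) dl).
have dc1 : derivable (D \o l) 0 1 by case: dc.
split; first exact: ((derivable1P (D \o q) x v).2 dc1).
have <- := @derive_val _ _ _ _ _ _ _ dc.
rewrite -derive1E /derive1 /derive /l.
by under [in RHS]eq_fun do rewrite /= addr0 scale0r add0r.
Qed.

(** A Faà di Bruno formula with unspecified coefficients. The order of the quantifiers matters: [L]
    depends on [q] and [s] alone, so one list serves a whole sequence of towers, and smallness of
    the derivatives in one variable yields smallness of the partial derivatives. *)
Lemma partials_comp q (s : seq 'I_d) : real_smooth q ->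
  exists2 L : seq ((V -> R) * nat), List.Forall (fun p => real_smooth p.1) L &
   forall D, derivative_tower D ->
    partials s (D 0%N \o q) = fun x => \sum_(p <- L) p.1 x * D p.2 (q x).
Proof.
move=> sq; elim: s => [|i s [L sL IH]].
  exists [:: ((fun=> 1) : V -> R, 0%N)].
    by constructor; [exact: real_smooth_cst|constructor].
  by move=> D _; apply/funext => x; rewrite big_seq1 mul1r.
exists ([seq (partial i p.1, p.2) | p <- L] ++
        [seq ((fun x => p.1 x * partial i q x) : V -> R, p.2.+1) | p <- L]).
  clear IH; rewrite List.Forall_app; elim: sL => [|p {}L sp _ [H1 H2]].
    by split; constructor.
  split; apply/List.Forall_cons_iff; split; last first.
  - exact: H2.
  - exact: (real_smoothM sp (real_smooth_partial i sq)).
  - exact: H1.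
  - exact: (real_smooth_partial i sp).
move=> D tD; rewrite /= -/(partials _ _) IH//; apply/funext => x; rewrite /partial.
rewrite big_cat /= !big_map /= -big_split /=.
suff H : is_derive x (delta_mx 0 i) (fun y => \sum_(p <- L) p.1 y * D p.2 (q y))
  (\sum_(p <- L) (partial i p.1 x * D p.2 (q x) + p.1 x * partial i q x * D p.2.+1 (q x))).
  exact: (@derive_val _ _ _ _ _ _ _ H).
clear IH; elim: sL => [|p {}L sp _ IHL].
  rewrite big_nil (_ : (fun _ => _) = cst 0); first exact: is_derive_cst.
  by apply/funext => y; rewrite big_nil.
rewrite big_cons (_ : (fun _ => _) = (p.1 * (D p.2 \o q)) +
   (fun y => \sum_(p <- L) p.1 y * D p.2 (q y))); last first.
  by apply/funext => y; rewrite big_cons.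
apply: is_deriveD.
have dp := derivableP (@real_smooth_derivable p.1 i x sp).
have dD := is_derive_comp_line (tD p.2) (@real_smooth_derivable q i x sq).
apply: (is_derive_eq (is_deriveM dp dD)).
by rewrite /GRing.scale/= /partial; ring.
Qed.

Lemma sum_tower_smooth q (L : seq ((V -> R) * nat)) D : real_smooth q ->
  List.Forall (fun p => real_smooth p.1) L -> derivative_tower D ->
  continuous (fun x => \sum_(p <- L) p.1 x * D p.2 (q x)) /\
  forall i x, derivable (fun x => \sum_(p <- L) p.1 x * D p.2 (q x)) x (delta_mx 0 i).
Proof.
move=> sq sL tD; elim: sL => [|p {}L sp _ [cL dL]].
  rewrite (_ : (fun _ => _) = cst 0); last by apply/funext => y; rewrite big_nil.
  by split=> [|i x]; [exact: cst_continuous|exact: derivable_cst].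
rewrite (_ : (fun _ => _) = (p.1 * (D p.2 \o q)) +
   (fun y => \sum_(p <- L) p.1 y * D p.2 (q y))); last first.
  by apply/funext => y; rewrite big_cons.
split=> [x|i x].
  have cD : {for q x, continuous (D p.2)}.
    apply: differentiable_continuous; apply/derivable1_diffP.
    by case: (tD p.2 (q x)).
  have c2 := @continuous_comp V R R q (D p.2) x (@real_smooth_continuous q sq x) cD.
  have c1 := @continuousM R V p.1 _ x (@real_smooth_continuous p.1 sp x) c2.
  exact: (@continuousD R _ V _ _ x c1 (cL x)).
have [dD _] := is_derive_comp_line (tD p.2) (@real_smooth_derivable q i x sq).
exact: (derivableD (derivableM (@real_smooth_derivable p.1 i x sp) dD) (dL i x)).
Qed.

Lemma real_smooth_comp q D : real_smooth q -> derivative_tower D ->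
  real_smooth (D 0%N \o q).
Proof.
move=> sq tD s; have [L sL ->//] := partials_comp s sq.
exact: sum_tower_smooth.
Qed.

End Smooth.

(** * Compactly supported distributions *)

Lemma normc_real (R : rcfType) (x : R) : `|x%:C| = `|x|%:C.
Proof. by rewrite normc_def /= expr0n addr0 sqrtr_sqr. Qed.

Section Pairing.
Variables (R : realType) (d : nat).
Local Notation V := 'rV[R]_d.
Implicit Types (g h q : V -> R) (f : compact_distribution R d).

Lemma compact_bounded_fun (K : set V) g : compact K -> continuous g ->
  exists2 M : R, 0 < M & forall x, K x -> `|g x| <= M.
Proof.
move=> cK cg.
have /compact_bounded[M0 [_ HM]] := @continuous_compact V R g K (continuous_subspaceT cg) cK.
exists (`|M0| + 1) => [|x Kx]; first by rewrite ltr_wpDl.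
apply: (HM (`|M0| + 1)); last by exists x.
by rewrite (le_lt_trans (ler_norm _))// ltrDl.
Qed.

Lemma smooth_real g : real_smooth g -> smooth (fun x => (g x)%:C).
Proof. by move=> sg; exact: (conj sg (real_smooth_cst 0)). Qed.

Lemma smooth_complex g h : real_smooth g -> real_smooth h ->
  smooth (fun x => g x +i* h x).
Proof. exact: conj. Qed.

Lemma pairing0 f : f (fun=> 0) = 0.
Proof.
have s0 : smooth (fun _ : V => 0 : R[i]) by split; exact: real_smooth_cst.
have := pairing_linear f 1 s0 s0.
under eq_fun do rewrite mulr0 addr0.
by rewrite mul1r => /eqP; rewrite -subr_eq0 opprD addNKr oppr_eq0 => /eqP.
Qed.

Lemma pairingD f phi psi : smooth phi -> smooth psi ->
  f (fun x => phi x + psi x) = f phi + f psi.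
Proof.
move=> s1 s2; rewrite -[f phi]mul1r -pairing_linear //.
by under [in RHS]eq_fun do rewrite mul1r.
Qed.

Lemma pairingZ f a phi : smooth phi -> f (fun x => a * phi x) = a * f phi.
Proof.
move=> s1; have s0 : smooth (fun _ : V => 0 : R[i]) by split; exact: real_smooth_cst.
have := pairing_linear f a s1 s0; rewrite pairing0 addr0 => <-.
by under [in RHS]eq_fun do rewrite addr0.
Qed.

Lemma pairing_complex f g h : real_smooth g -> real_smooth h ->
  f (fun x => g x +i* h x) = f (fun x => (g x)%:C) + 'i * f (fun x => (h x)%:C).
Proof.
move=> sg sh; rewrite -pairingZ; last exact: smooth_real.
rewrite -pairingD; last 2 first.
- exact: smooth_real.
- rewrite (_ : (fun x => _) = (fun x => 0 +i* h x)); first exact: (smooth_complex (real_smooth_cst 0) sh).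
  by apply/funext => x; simpc.
by congr (pairing f _); apply/funext => x; simpc.
Qed.

Lemma partials_cst0 (s : seq 'I_d) : partials s (fun _ : V => 0 : R) = fun=> 0.
Proof. by elim: s => //= i s ->; exact: partial_cst. Qed.

Lemma pairing_small f (e : R) : 0 < e ->
  exists (K : set V) (m : nat) (delta : R), [/\ compact K, 0 < delta &
    forall g, real_smooth g ->
      (forall s : seq 'I_d, (size s <= m)%N -> forall x, K x ->
         `|partials s g x| < delta) -> `|f (fun x => (g x)%:C)| < e%:C].
Proof.
move=> e0; have s0 : smooth (fun _ : V => 0 : R[i]) by split; exact: real_smooth_cst.
have [K [m [delta [cK d0 H]]]] := pairing_continuous f s0 e0.
exists K, m, delta; split=> // g sg Hg.
have := H _ (smooth_real sg); rewrite pairing0 subr0; apply=> s sm x Kx.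
rewrite /cpartials /= (_ : (fun y => (g y)) = g) // !partials_cst0.
have -> : partials s g x +i* 0 - 0 = (partials s g x)%:C by simpc.
by rewrite normc_real ltcR; exact: Hg.
Qed.

Lemma sum_tower_cvg0 (K : set V) q (L : seq ((V -> R) * nat)) (D : nat -> nat -> R -> R) :
  compact K -> real_smooth q -> List.Forall (fun p => real_smooth p.1) L ->
  (forall j (T e : R), 0 < e -> exists N, forall n t, (N <= n)%N -> `|t| <= T ->
     `|D n j t| <= e) ->
  forall e : R, 0 < e -> exists N, forall n, (N <= n)%N -> forall x, K x ->
    `|\sum_(p <- L) p.1 x * D n p.2 (q x)| <= e.
Proof.
move=> cK sq sL HD; have [T T0 HT] := compact_bounded_fun cK (real_smooth_continuous sq).
elim: sL => [|p {}L sp _ IH] e e0.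
  by exists 0%N => n _ x _; rewrite big_nil normr0 ltW.
have [M M0 HM] := compact_bounded_fun cK (real_smooth_continuous sp).
have e2 : 0 < e / 2 by rewrite divr_gt0.
have [N1 H1] := IH _ e2.
have [N2 H2] := HD p.2 T (e / 2 / M) (divr_gt0 e2 M0).
exists (maxn N1 N2) => n; rewrite geq_max => /andP[n1 n2] x Kx.
rewrite big_cons (splitr e) (le_trans (ler_normD _ _))// lerD ?H1//.
rewrite normrM -(divfK (lt0r_neq0 M0) (e / 2)) [leRHS]mulrC.
by apply: ler_pM => //; [exact: HM|exact: H2 (HT _ Kx)].
Qed.

Lemma pairing_tower_cvg0 f q (D : nat -> nat -> R -> R) :
  real_smooth q -> (forall n, derivative_tower (D n)) ->
  (forall j (T e : R), 0 < e -> exists N, forall n t, (N <= n)%N -> `|t| <= T ->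
     `|D n j t| <= e) ->
  forall e : R, 0 < e -> exists N, forall n, (N <= n)%N ->
    `|f (fun x => (D n 0%N (q x))%:C)| < e%:C.
Proof.
move=> sq tD HD e e0; have [K [m [delta [cK d0 H]]]] := pairing_small f e0.
(* The threshold depends on [s]. Bounded sequences over ['I_d] form a finite type, so the maximum of
   the thresholds exists. *)
have HN (s : {bseq m of 'I_d}) : exists N, forall n, (N <= n)%N -> forall x, K x ->
    `|partials s (D n 0%N \o q) x| <= delta / 2.
  have [L sL HL] := partials_comp s sq.
  have [N HN] := sum_tower_cvg0 cK sq sL HD (divr_gt0 d0 (ltr0n _ 2)).
  by exists N => n Nn x Kx; rewrite HL//; exact: HN.
have [N {}HN] := choice HN.
exists (\max_(s : {bseq m of 'I_d}) N s) => n Nn.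
apply: (H (D n 0%N \o q)); first exact: real_smooth_comp.
move=> s sm x Kx; apply: (@le_lt_trans _ _ (delta / 2)); last first.
  by rewrite ltr_pdivrMr // mulr_natr mulr2n ltrDl.
apply: (HN (Bseq sm)) => //; apply: leq_trans Nn.
exact: (leq_bigmax (Bseq sm)).
Qed.

End Pairing.

(** * Entire series under a distribution *)

Section ComplexLimits.
Variable R : realType.
Implicit Types (u : nat -> R[i]^o) (l : R[i]^o).

Lemma complex_gt0 (z : R[i]) : 0 < z -> z = (complex.Re z)%:C /\ 0 < complex.Re z.
Proof. by case: z => a b; rewrite ltcE /= => /andP[/eqP-> ?]. Qed.

Lemma cvgn_complexP u l :
  (forall e : R, 0 < e -> exists N, forall n, (N <= n)%N -> `|u n - l| < e%:C) ->
  u @ \oo --> l.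
Proof.
move=> H; apply/cvgrPdist_lt => e /complex_gt0[-> /H[N HN]].
by exists N => // n /= Nn; rewrite distrC HN.
Qed.

End ComplexLimits.

(** Infinite radius of convergence of the power series with coefficients [c], in Cauchy-Hadamard
    form. *)
Definition entire (K : numDomainType) (c : nat -> K) :=
  forall r : K, 0 < r -> exists C, forall n, `|c n| <= C * r ^+ n.

Section GeometricSeries.
Variable R : realType.
Implicit Types (a c : nat -> R).

Lemma geometric_majorant_cvg a (C : R) : (forall n, `|a n| <= C * 2^-1 ^+ n) ->
  cvgn (series a).
Proof.
move=> H; apply: normed_cvg.
apply: (@series_le_cvg _ _ (geometric C 2^-1)) => [n|n|n|] //=.
- exact: le_trans (H n).
- apply: is_cvg_geometric_series; rewrite ger0_norm ?invr_ge0//.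
  by rewrite invf_lt1// ltr1n.
Qed.

Lemma geometric_majorant_sum a (C : R) m n : (forall n, `|a n| <= C * 2^-1 ^+ n) ->
  (forall n, (n < m)%N -> a n = 0) ->
  \sum_(0 <= k < n) `|a k| <= 2 * C * 2^-1 ^+ m.
Proof.
move=> H Hm; have C0 : 0 <= C by have := le_trans (normr_ge0 _) (H 0%N); rewrite mulr1.
(* The exact value of the geometric sum from [m] to [n - 1] makes the bound inductive. *)
suff : \sum_(0 <= k < n) `|a k| <= 2 * C * (2^-1 ^+ m - 2^-1 ^+ (maxn m n)).
  move/le_trans; apply; rewrite ler_wpM2l ?mulr_ge0// gerBl.
  by rewrite exprn_ge0// invr_ge0.
elim: n => [|n IH]; first by rewrite big_nil maxn0 subrr mulr0.
rewrite big_nat_recr//=; case: (ltnP n m) => nm.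
  rewrite Hm// normr0 addr0; move: IH.
  by rewrite (maxn_idPl (ltnW nm)) (maxn_idPl nm).
move: IH; rewrite (maxn_idPr nm) (maxn_idPr (leqW nm)) => IH.
rewrite (le_trans (lerD IH (H n)))// exprS.
by rewrite [leLHS](_ : _ = 2 * C * (2^-1 ^+ m - 2^-1 * 2^-1 ^+ n))//; field.
Qed.

Lemma geometric_majorant_lim a (C : R) m : (forall n, `|a n| <= C * 2^-1 ^+ n) ->
  (forall n, (n < m)%N -> a n = 0) ->
  `|limn (series a)| <= 2 * C * 2^-1 ^+ m.
Proof.
move=> H Hm; have ca := geometric_majorant_cvg H.
rewrite -lim_norm//; apply: limr_le; first exact: is_cvg_norm.
apply: nearW => n; apply: le_trans (geometric_majorant_sum n H Hm).
exact: ler_norm_sum.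
Qed.

Lemma entire_const_ge0 (K : numDomainType) (r C : K) (c : nat -> K) :
  (forall n, `|c n| <= C * r ^+ n) -> 0 <= C.
Proof. by move=> /(_ 0%N)/(le_trans (normr_ge0 _)); rewrite mulr1. Qed.

Lemma entire_diffs c : entire c -> entire (pseries_diffs c).
Proof.
(* Halving the ratio gains 2^-n, which absorbs the factor n + 1 produced by differentiation. *)
move=> ec r r0; have [C HC] := ec (r / 2) (divr_gt0 r0 (ltr0n _ 2)).
have C0 := entire_const_ge0 HC.
exists (C * (r / 2)) => n; rewrite /pseries_diffs normrM normr_nat.
apply: le_trans (ler_wpM2l (ler0n _ _) (HC n.+1)) _.
have -> : n.+1%:R * (C * (r / 2) ^+ n.+1) = C * (r / 2) * r ^+ n * (n.+1%:R / 2 ^+ n).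
  rewrite exprS expr_div_n; have : (2 ^+ n : R) != 0 by rewrite expf_neq0.
  by move: (2 ^+ n) => x x0; field.
apply: ler_piMr; first by rewrite !mulr_ge0 ?exprn_ge0 ?invr_ge0 ?(ltW r0).
by rewrite ler_pdivrMr ?exprn_gt0// mul1r -natrX ler_nat ltn_expl.
Qed.

Lemma entire_majorant c (T : R) : entire c -> exists2 C, 0 <= C & forall n t, `|t| <= T ->
  `|c n * t ^+ n| <= C * 2^-1 ^+ n.
Proof.
move=> ec; have T0 : 0 < `|T| + 1 by rewrite ltr_wpDl.
(* With this ratio r one has r |t| <= 1/2 whenever |t| <= T; adding 1 avoids a zero denominator. *)
have r0 : 0 < 2^-1 / (`|T| + 1) by rewrite divr_gt0 ?invr_gt0.
have [C HC] := ec _ r0.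
exists C => [|n t tT]; first exact: entire_const_ge0 HC.
rewrite normrM normrX.
apply: le_trans (ler_wpM2r (exprn_ge0 _ (normr_ge0 _)) (HC n)) _.
rewrite -mulrA ler_wpM2l ?(entire_const_ge0 HC)// -exprMn lerXn2r ?nnegrE ?mulr_ge0 ?invr_ge0 ?(ltW T0)//.
rewrite -mulrA -[leRHS]mulr1 ler_wpM2l ?invr_ge0// mulrC ler_pdivrMr// mul1r.
by rewrite (le_trans tT)// (le_trans (ler_norm _))// lerDl.
Qed.

Lemma entire_cvg c (t : R) : entire c -> cvgn (pseries c t).
Proof.
move=> /(entire_majorant `|t|)[C _ HC].
by apply: (@geometric_majorant_cvg _ C) => n; exact: HC.
Qed.

Definition pseries_tower c (j : nat) (t : R) := limn (pseries (iter j (@pseries_diffs R) c) t).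

Lemma entire_iter_diffs c j : entire c -> entire (iter j (@pseries_diffs R) c).
Proof. by move=> ec; elim: j => //= j; exact: entire_diffs. Qed.

Lemma pseries_tower_derivative c : entire c -> derivative_tower (pseries_tower c).
Proof.
move=> ec j t; apply: (@pseries_snd_diffs _ _ (`|t| + 1)).
- by apply: entire_cvg; exact: entire_iter_diffs.
- by apply: entire_cvg; exact: (@entire_iter_diffs _ j.+1).
- by apply: entire_cvg; exact: (@entire_iter_diffs _ j.+2).
- by rewrite [ltRHS]ger0_norm ?addr_ge0// ltrDl.
Qed.

Definition pseries_tail c (n k : nat) : R := if (k < n)%N then 0 else c k.

Lemma entire_tail c n : entire c -> entire (pseries_tail c n).
Proof.
move=> ec r r0; have [C HC] := ec r r0; exists C => k.
rewrite /pseries_tail; case: ifP => // _.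
by rewrite normr0 mulr_ge0 ?(entire_const_ge0 HC)// exprn_ge0// ltW.
Qed.

Lemma iter_diffs_tail c n j k : iter j (@pseries_diffs R) (pseries_tail c n) k =
  if (k + j < n)%N then 0 else iter j (@pseries_diffs R) c k.
Proof.
elim: j k => [|j IH] k; first by rewrite addn0.
by rewrite /= {1 3}/pseries_diffs IH addSnnS; case: ifP => //; rewrite mulr0.
Qed.

Lemma pseries_tail_small c j (T e : R) : entire c -> 0 < e ->
  exists N, forall n t, (N <= n)%N -> `|t| <= T ->
    `|pseries_tower (pseries_tail c n) j t| <= e.
Proof.
move=> ec e0; have [C C0 HC] := entire_majorant T (entire_iter_diffs j ec).
have [N HN] : exists N, 2 * C * 2^-1 ^+ N <= e.
  have h1 : `|2^-1 : R| < 1 by rewrite ger0_norm ?invr_ge0// invf_lt1// ltr1n.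
  have /cvgrPdist_lt/(_ _ e0)[N _ /(_ N (leqnn N))] := cvg_geometric (2 * C) h1.
  by rewrite sub0r normrN => /ltW/(le_trans (ler_norm _)); exists N.
(* Each of the [j] differentiations lowers the first index of the tail by one, hence the shift. *)
exists (N + j)%N => n t Nn tT; apply: le_trans HN.
apply: geometric_majorant_lim => k.
  rewrite /= iter_diffs_tail; case: ifP => _; last exact: HC.
  by rewrite mul0r normr0 mulr_ge0// exprn_ge0// invr_ge0.
move=> kN; rewrite /= iter_diffs_tail ifT ?mul0r//.
by apply: leq_trans Nn; rewrite ltn_add2r.
Qed.

End GeometricSeries.

Section PairingPseries.
Variables (R : realType) (d : nat).
Local Notation V := 'rV[R]_d.
Implicit Types (q : V -> R) (f : compact_distribution R d) (c : nat -> R).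

Lemma real_smooth_pseries q c : real_smooth q -> entire c ->
  real_smooth (fun x => limn (pseries c (q x))).
Proof. by move=> sq /pseries_tower_derivative; exact: real_smooth_comp. Qed.

Lemma pseries_split c n (t : R) : entire c ->
  limn (pseries c t) = \sum_(0 <= k < n) c k * t ^+ k + limn (pseries (pseries_tail c n) t).
Proof.
move=> ec; set S := \sum_(0 <= k < n) _.
suff -> : limn (pseries (pseries_tail c n) t) = limn (pseries c t) - S.
  by rewrite addrC subrK.
apply: cvg_lim => //; apply: cvg_trans (cvgB (entire_cvg ec) (cvg_cst S)).
apply: near_eq_cvg; exists n => // N /= nN; rewrite !fctE /cst /pseries /series /=.
rewrite !(big_cat_nat (leq0n n) nN) /= -/S.
rewrite addrAC subrr add0r [X in _ = X + _]big1_seq ?add0r => [|k].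
  by apply: eq_big_nat => k /andP[nk _]; rewrite /pseries_tail ltnNge nk.
by rewrite mem_index_iota /pseries_tail => /= ->; rewrite mul0r.
Qed.

Lemma pairing_sum f q c n : real_smooth q ->
  f (fun x => (\sum_(0 <= k < n) c k * q x ^+ k)%:C) =
  \sum_(0 <= k < n) (c k)%:C * f (fun x => (q x ^+ k)%:C).
Proof.
move=> sq; elim: n => [|n IH].
  rewrite big_nil -(pairing0 f); congr (pairing f _).
  by apply/funext => x; rewrite big_nil.
rewrite big_nat_recr//= -IH -pairingZ; last exact/smooth_real/real_smoothX.
rewrite -pairingD.
- congr (pairing f _); apply/funext => x.
  by rewrite big_nat_recr//= rmorphD rmorphM.
- by apply/smooth_real/real_smooth_sum => i; exact/(real_smoothM (real_smooth_cst _))/real_smoothX.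
- rewrite (_ : (fun x => _) = (fun x => (c n * q x ^+ n)%:C)); last first.
    by apply/funext => x; rewrite rmorphM.
  exact/smooth_real/(real_smoothM (real_smooth_cst _))/real_smoothX.
Qed.

(** The error after [n] terms is [f] applied to the tail, which tends to 0 by [pairing_tower_cvg0]:
    each derivative of the tail is uniformly small on bounded sets. *)
Lemma pairing_pseries f q c : real_smooth q -> entire c ->
  series (fun k => (c k)%:C * f (fun x => (q x ^+ k)%:C) : R[i]^o) @ \oo -->
  (f (fun x => (limn (pseries c (q x)))%:C) : R[i]^o).
Proof.
move=> sq ec; apply: cvgn_complexP => e e0.
have tD n := pseries_tower_derivative (entire_tail n ec).
have [N HN] := @pairing_tower_cvg0 R d f q _ sq tD (fun j T e => @pseries_tail_small _ c j T e ec) e e0.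
exists N => n /HN; rewrite distrC /series /= -pairing_sum//.
suff -> : f (fun x => (limn (pseries c (q x)))%:C) =
   f (fun x => (\sum_(0 <= k < n) c k * q x ^+ k)%:C) +
   f (fun x => (pseries_tower (pseries_tail c n) 0 (q x))%:C).
  by rewrite addrAC subrr add0r.
rewrite -pairingD.
- by congr (pairing f _); apply/funext => x; rewrite (pseries_split n)// rmorphD.
- by apply/smooth_real/real_smooth_sum => i; exact/(real_smoothM (real_smooth_cst _))/real_smoothX.
- exact/smooth_real/(real_smooth_comp sq)/tD.
Qed.

End PairingPseries.

(** * Moments of radial distributions *)

Lemma poly_eq0_nat (K : numDomainType) (p : {poly K}) :
  (forall n : nat, p.[n%:R] = 0) -> p = 0.
Proof.
move=> H; apply: (@roots_geq_poly_eq0 _ p [seq n%:R | n <- iota 0 (size p)]).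
- by apply/allP => _ /mapP[n _ ->]; rewrite /root H.
- rewrite map_inj_uniq ?iota_uniq// => m n /eqP; rewrite eqr_nat => /eqP//.
- by rewrite size_map size_iota.
Qed.

Section Householder.
Variables (R : realType) (d : nat).
Local Notation V := 'rV[R]_d.

(** The reflection in the hyperplane orthogonal to [v]. For [v = 0] the inverse of 0 is 0 and the
    matrix is the identity, still orthogonal. *)
Definition householder (v : V) : 'M[R]_d := 1%:M - (2 / dot v v) *: (v^T *m v).

Lemma dotE (x y : V) : (x *m y^T) 0 0 = dot x y.
Proof. by rewrite mxE; apply: eq_bigr => i _; rewrite mxE. Qed.

Lemma mulmx_dot (x y z : V) : x *m (y^T *m z) = dot x y *: z.
Proof. by rewrite mulmxA [x *m _]mx11_scalar mul_scalar_mx dotE. Qed.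

Lemma householder_orthogonal (v : V) : householder v *m (householder v)^T = 1%:M.
Proof.
have -> : (householder v)^T = householder v.
  by rewrite /householder linearB linearZ /= trmx1 trmx_mul trmxK.
rewrite /householder; set c := 2 / _; set w := v^T *m v.
have ww : w *m w = dot v v *: w by rewrite /w -mulmxA mulmx_dot scalemxAr.
rewrite mulmxBl mul1mx mulmxBr mulmx1 -scalemxAl -scalemxAr ww !scalerA.
suff -> : c * c * dot v v = c + c by rewrite scalerDl opprB addrK subrK.
rewrite /c; have [->|v0] := eqVneq (dot v v) 0; first by rewrite invr0; ring.
by field.
Qed.

Lemma mulmx_householder (x v : V) (i : 'I_d) :
  (x *m householder v) 0 i = x 0 i - 2 / dot v v * dot x v * v 0 i.
Proof.
by rewrite /householder mulmxBr mulmx1 -scalemxAr mulmx_dot !mxE mulrA.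
Qed.

Lemma dot_trmx (A : 'M[R]_d) (x : V) : A *m A^T = 1%:M -> dot (x *m A) (x *m A) = dot x x.
Proof. by move=> AA; rewrite -!dotE trmx_mul mulmxA -(mulmxA x) AA mulmx1. Qed.

Lemma dotC (x y : V) : dot x y = dot y x.
Proof. by apply: eq_bigr => i _; rewrite mulrC. Qed.

Lemma dotDr (x y z : V) : dot x (y + z) = dot x y + dot x z.
Proof. by rewrite -big_split; apply: eq_bigr => i _; rewrite mxE mulrDr. Qed.

Lemma dotZr (a : R) (x y : V) : dot x (a *: y) = a * dot x y.
Proof. by rewrite mulr_sumr; apply: eq_bigr => i _; rewrite mxE mulrCA. Qed.

Lemma dot_delta (x : V) (i : 'I_d) : dot x (delta_mx 0 i) = x 0 i.
Proof.
rewrite /dot (bigD1 i)//= big1 => [|j ji]; rewrite !mxE ?eqxx ?mulr1 ?addr0//.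
by rewrite (negbTE ji) andbF mulr0.
Qed.

Lemma dot_ge0 (x : V) : 0 <= dot x x.
Proof. by apply: sumr_ge0 => i _; rewrite -expr2 sqr_ge0. Qed.

Lemma dot_eq0 (x : V) : dot x x = 0 -> x = 0.
Proof.
move=> /eqP; rewrite psumr_eq0 => [/allP H|i _]; last by rewrite -expr2 sqr_ge0.
apply/rowP => i; rewrite mxE; have := H i (mem_index_enum i).
by rewrite /= mulf_eq0 orbb => /eqP.
Qed.

Lemma enorm_sqr (x : V) : enorm x ^+ 2 = dot x x.
Proof. by rewrite sqr_sqrtr// dot_ge0. Qed.

Lemma dot0 (x : V) : dot 0 x = 0.
Proof. by rewrite /dot big1// => i _; rewrite mxE mul0r. Qed.

Lemma enorm0 : enorm (0 : V) = 0.
Proof. by rewrite /enorm dot0 sqrtr0. Qed.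

Lemma orthogonal_to_axis (u : V) (i : 'I_d) : dot u u = 1 ->
  exists2 A : 'M[R]_d, A *m A^T = 1%:M & forall x : V, (x *m A) 0 i = dot u x.
Proof.
(* The reflection along the difference of two unit vectors exchanges them, here [u] and the i-th
   basis vector. *)
move=> u1; pose v := u + (- 1) *: delta_mx 0 i.
exists (householder v) => [|x]; first exact: householder_orthogonal.
have vi : v 0 i = u 0 i - 1 by rewrite !mxE !eqxx mulN1r.
have vv : dot v v = - 2 * v 0 i.
  rewrite {2}/v dotDr dotZr dot_delta dotC /v dotDr dotZr dot_delta u1 vi; ring.
have xv : dot x v = dot u x - x 0 i.
  by rewrite /v dotDr dotZr dot_delta (dotC x) mulN1r.
rewrite mulmx_householder xv vv.
(* As [dot v v] is a multiple of [v 0 i], the degenerate case is exactly that of [u] being the basis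
   vector. *)
have [v0|v0] := eqVneq (v 0 i) 0; last by field.
have : v = 0 by apply: dot_eq0; rewrite vv v0 mulr0.
move=> v00; rewrite v0 mulr0 subr0.
by apply/esym/eqP; rewrite -subr_eq0 -xv v00 /dot big1// => j _; rewrite mxE mulr0.
Qed.

End Householder.

Section RadialMoments.
Variables (R : realType) (d : nat) (f : compact_distribution R d).
Hypothesis hf : radial f.
Local Notation V := 'rV[R]_d.
Implicit Types (g : V -> R).

Lemma pairing_realZ (a : R) g : real_smooth g ->
  f (fun x => (a * g x)%:C) = a%:C * f (fun x => (g x)%:C).
Proof.
move=> sg; rewrite -pairingZ; last exact: smooth_real.
by congr (pairing f _); apply/funext => x; rewrite rmorphM.
Qed.

Lemma pairing_real_sum (I : Type) (r : seq I) (F : I -> V -> R) :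
  (forall i, real_smooth (F i)) ->
  f (fun x => (\sum_(i <- r) F i x)%:C) = \sum_(i <- r) f (fun x => (F i x)%:C).
Proof.
move=> sF; elim: r => [|i r IH].
  rewrite big_nil -(pairing0 f); congr (pairing f _).
  by apply/funext => x; rewrite big_nil.
rewrite big_cons -IH -pairingD.
- by congr (pairing f _); apply/funext => x; rewrite big_cons rmorphD.
- exact/smooth_real/sF.
- exact/smooth_real/real_smooth_sum.
Qed.

Let sdot j := real_smoothX j (@real_smooth_dotxx R d).

Lemma radial_moment_axis (xi : V) (i : 'I_d) j n :
  f (fun x => (dot x x ^+ j * dot xi x ^+ n)%:C) =
  (enorm xi ^+ n)%:C * f (fun x => (dot x x ^+ j * x 0 i ^+ n)%:C).
Proof.
have s1 : real_smooth (fun x : V => dot x x ^+ j * x 0 i ^+ n).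
  exact: (real_smoothM (sdot j) (real_smoothX n (@real_smooth_coord R d i))).
rewrite -(pairing_realZ _ s1).
(* The vector 0 cannot be normalized, but then both sides carry the factor [0 ^+ n], which is 1 for
   [n = 0]. *)
have [xi0|xi0] := eqVneq (dot xi xi) 0.
  rewrite (dot_eq0 xi0) enorm0; congr (pairing f _); apply/funext => x.
  rewrite dot0; have [->|n0] := eqVneq n 0%N; first by rewrite !expr0 mul1r.
  by rewrite expr0n (negbTE n0) mul0r mulr0.
have e0 : enorm xi != 0 by rewrite -sqrf_eq0 enorm_sqr.
have [|A AA HA] := @orthogonal_to_axis R d ((enorm xi)^-1 *: xi) i.
  by rewrite dotZr dotC dotZr -enorm_sqr; field.
have s2 := real_smoothM (real_smooth_cst (enorm xi ^+ n)) s1.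
rewrite -(hf AA (smooth_real s2)); congr (pairing f _); apply/funext => x.
rewrite HA dot_trmx// [dot (_ *: _) x]dotC dotZr (dotC x xi) exprMn exprVn mulrCA mulVKf//.
by rewrite expf_neq0.
Qed.

Lemma radial_moment_odd (xi : V) n : odd n -> f (fun x => (dot xi x ^+ n)%:C) = 0.
Proof.
move=> on; have s1 := smooth_real (real_smoothX n (real_smooth_dot xi)).
have AA : (- 1%:M : 'M[R]_d) *m (- 1%:M)^T = 1%:M.
  by rewrite linearN /= trmx1 mulmxN mulNmx mulmx1 opprK.
have := hf AA s1; rewrite (_ : (fun x => _) = fun x => -1 * (dot xi x ^+ n)%:C).
  rewrite pairingZ// mulN1r => /eqP; rewrite eq_sym -addr_eq0 -mulr2n.
  by rewrite mulrn_eq0 /= => /eqP.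
apply/funext => x; rewrite mulmxN mulmx1 -scaleN1r dotZr exprMn -signr_odd on.
by rewrite expr1 rmorphM rmorphN rmorph1.
Qed.

(* Comparison of the coefficients of [t ^ 2] in
   [f (|x|^(2j) (x_i + t x_k)^(2n+2)) =
    (1 + t ^ 2)^(n+1) f (|x|^(2j) x_i^(2n+2))]. *)
Lemma radial_moment_cross (i k : 'I_d) j n : k != i ->
  (n.*2.+1)%:R * f (fun x => (dot x x ^+ j * (x 0 i ^+ n.*2 * x 0 k ^+ 2))%:C) =
  f (fun x => (dot x x ^+ j * x 0 i ^+ n.+1.*2)%:C).
Proof.
move=> ki; set M := RHS.
pose N := n.+1.*2.
pose F (r : nat) : V -> R := fun x => dot x x ^+ j * (x 0 i ^+ (N - r) * x 0 k ^+ r).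
have sF r : real_smooth (F r).
  apply: (real_smoothM (sdot j)).
  exact: (real_smoothM (real_smoothX _ (@real_smooth_coord R d i)) (real_smoothX r (@real_smooth_coord R d k))).
pose p : {poly R[i]} := \poly_(r < N.+1) ('C(N, r)%:R * f (fun x => (F r x)%:C))
  - M *: (1 + 'X^2) ^+ n.+1.
have p0 : p = 0.
  (* Moments along e_i + t e_k, a vector of squared length 1 + t^2. The natural values of t suffice
     to identify the coefficients of a polynomial. *)
  apply: poly_eq0_nat => t; pose v : V := delta_mx 0 i + t%:R *: delta_mx 0 k.
  have vx (x : V) : dot v x = x 0 i + t%:R * x 0 k.
    by rewrite dotC /v dotDr dotZr !dot_delta.
  have eN : enorm v ^+ N = (1 + t%:R ^+ 2) ^+ n.+1.
    rewrite /N -mul2n exprM enorm_sqr vx !mxE !eqxx (negbTE ki) eq_sym (negbTE ki) /=.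
    by congr (_ ^+ _); ring.
  have := radial_moment_axis v i j N; rewrite eN -/M => H.
  rewrite /p hornerD hornerN hornerZ horner_exp hornerD hornerXn hornerC horner_poly.
  rewrite [M * _]mulrC.
  have -> : (1 + t%:R ^+ 2 : R[i]) ^+ n.+1 = ((1 + t%:R ^+ 2) ^+ n.+1 : R)%:C.
    by rewrite rmorphXn rmorphD rmorph1 rmorphXn rmorph_nat.
  apply/eqP; rewrite subr_eq0 -H; apply/eqP.
  transitivity (\sum_(r < N.+1) f (fun x => ('C(N, r)%:R * t%:R ^+ r * F r x)%:C)).
    apply: eq_bigr => r _; rewrite pairing_realZ// mulrAC.
    by rewrite !rmorphM rmorphXn !rmorph_nat.
  rewrite -pairing_real_sum => [|r]; last exact: (real_smoothM (real_smooth_cst _) (sF r)).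
  congr (pairing f _); apply/funext => x; congr (_%:C).
  rewrite vx exprDn mulr_sumr; apply: eq_bigr => r _.
  by rewrite -mulr_natr exprMn /F; ring.
have : p`_2 = 0 by rewrite p0 coef0.
rewrite /p coefB coefZ coef_poly /= => /eqP; rewrite subr_eq0 => /eqP.
(* The other side has ['C(N, 2) = n.+1 * n.*2.+1], so that [n.+1] cancels in the end. *)
have -> : ((1 + 'X^2) ^+ n.+1 : {poly R[i]})`_2 = n.+1%:R.
  suff [] : ((1 + 'X^2) ^+ n.+1 : {poly R[i]})`_0 = 1 /\
            ((1 + 'X^2) ^+ n.+1 : {poly R[i]})`_2 = n.+1%:R by [].
  elim: (n.+1) => [|m [IH0 IH2]]; first by rewrite expr0 !coefC.
  rewrite exprSr mulrDr mulr1 !coefD !coefMXn /= IH0 IH2.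
  by split; [rewrite addr0|rewrite addrC nat1r].
have -> : (fun x => (F 2%N x)%:C) = (fun x => (dot x x ^+ j * (x 0 i ^+ n.*2 * x 0 k ^+ 2))%:C).
  by apply/funext => x; rewrite /F /N doubleS subSS subSS subn0.
have -> : 'C(N, 2) = (n.+1 * n.*2.+1)%N.
  by rewrite bin2 /N -[X in (_ * X)./2]/(n.*2.+1) -doubleMl doubleK.
rewrite natrM -mulrA => H; apply: (@mulfI _ (n.+1%:R : R[i])); first by rewrite pnatr_eq0.
by rewrite H mulrC.
Qed.

(** Write one factor |x|^2 as the sum of the squared coordinates. After multiplication by 2n + 1,
    the i-th square gives 2n + 1 copies of the moment on the right and each of the d - 1 others
    gives one. *)
Lemma radial_moment_rec (i : 'I_d) j n :
  (n.*2.+1)%:R * f (fun x => (dot x x ^+ j.+1 * x 0 i ^+ n.*2)%:C) =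
  (n.*2 + d)%:R * f (fun x => (dot x x ^+ j * x 0 i ^+ n.+1.*2)%:C).
Proof.
set M := f (fun x => (dot x x ^+ j * x 0 i ^+ n.+1.*2)%:C).
have -> : (fun x : V => (dot x x ^+ j.+1 * x 0 i ^+ n.*2)%:C) =
  (fun x => (\sum_k dot x x ^+ j * (x 0 i ^+ n.*2 * x 0 k ^+ 2))%:C).
  apply/funext => x; congr (_ %:C); rewrite exprSr -mulrA -mulr_sumr; congr (_ * _).
  by rewrite mulrC -mulr_sumr; congr (_ * _); apply: eq_bigr => k _; rewrite expr2.
rewrite pairing_real_sum => [|k]; last first.
  apply: (real_smoothM (sdot j)).
  exact: (real_smoothM (real_smoothX _ (@real_smooth_coord R d i)) (real_smoothX 2 (@real_smooth_coord R d k))).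
rewrite (bigD1 i)//= mulrDr mulr_sumr (eq_bigr (fun=> M)) => [|k ki]; last first.
  exact: radial_moment_cross.
rewrite sumr_const cardC1 card_ord.
have -> : (fun x : V => (dot x x ^+ j * (x 0 i ^+ n.*2 * x 0 i ^+ 2))%:C) =
   (fun x => (dot x x ^+ j * x 0 i ^+ n.+1.*2)%:C).
  by apply/funext => x; rewrite -exprD addn2.
rewrite -/M -[M *+ _]mulr_natl -mulrDl -natrD; congr (_%:R * _).
by rewrite addSnnS prednK// (leq_trans _ (ltn_ord i)).
Qed.

(** The product is the mean of u_1^(2n) over the unit sphere. It arises by iterating
    [radial_moment_rec], which trades two powers of a coordinate for one of |x|^2. *)
Lemma radial_moment_even (hd : (0 < d)%N) (xi : V) n :
  f (fun x => (dot xi x ^+ n.*2)%:C) =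
  ((\prod_(k < n) (k.*2.+1%:R / (k.*2 + d)%:R)) * enorm xi ^+ n.*2)%:C *
   f (fun x => (dot x x ^+ n)%:C).
Proof.
have i : 'I_d := Ordinal hd.
have H k j : f (fun x => (dot x x ^+ j * x 0 i ^+ k.*2)%:C) =
  (\prod_(l < k) (l.*2.+1%:R / (l.*2 + d)%:R : R))%:C * f (fun x => (dot x x ^+ (j + k))%:C).
  elim: k j => [|k IH] j.
    rewrite big_ord0 mul1r addn0; congr (pairing f _).
    by apply/funext => x; rewrite mulr1.
  have d0 : (k.*2 + d)%:R != 0 :> R[i] by rewrite pnatr_eq0 -lt0n addn_gt0 hd orbT.
  apply: (mulfI d0); rewrite -radial_moment_rec IH addSnnS big_ord_recr /=.
  rewrite [in RHS]rmorphM /= [X in _ = _ * (_ * X * _)]fmorph_div /= !rmorph_nat.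
  by move: (_%:R) d0 => c c0; field.
have := radial_moment_axis xi i 0 n.*2.
rewrite H add0n mulrA -rmorphM [X in X%:C]mulrC => <-.
by congr (pairing f _); apply/funext => x; rewrite mul1r.
Qed.

End RadialMoments.

(** * The Gamma function *)

Section GammaFunction.
Variable R : realType.
Local Notation mu := (@lebesgue_measure R).
Implicit Types (x y t : R).

Definition gamma_density y t : R := t `^ y * expR (- t).

Local Notation h := gamma_density.

Lemma gamma_density_ge0 y t : 0 <= h y t.
Proof. by rewrite mulr_ge0 ?powR_ge0 ?expR_ge0. Qed.

Lemma measurable_gamma_density y : measurable_fun [set: R] (h y).
Proof.
apply: measurable_funM; first exact: measurable_powR.
by apply: measurableT_comp => //; exact: measurableT_comp.
Qed.

Lemma is_derive_gamma_density x t : 0 < t ->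
  is_derive t 1 (h x) (x * h (x - 1) t - h x t).
Proof.
move=> t0; have d1 := is_derive1_powR x t0.
have d2 : is_derive t 1 (fun s : R => expR (- s)) (- expR (- t)).
  have := @is_derive1_comp R expR -%R t (expR (- t)) (-1) (is_derive_expR _).
  by rewrite mulrN1; apply; exact: is_deriveNid.
by apply: (is_derive_eq (is_deriveM d1 d2)); rewrite /GRing.scale/= /h; ring.
Qed.

Lemma continuous_gamma_density x t : 0 < t -> {for t, continuous (h x)}.
Proof.
move=> /(is_derive_gamma_density x)[d _].
by apply: differentiable_continuous; exact/derivable1_diffP.
Qed.

(** The half-line is exhausted by the compact intervals [[lo n], [hi n]]; the offset 2 keeps them
    nondegenerate around 1 from [n = 0] on. *)
Let lo n : R := n.+2%:R^-1.
Let hi n : R := n.+2%:R.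

Let lo_gt0 n : 0 < lo n. Proof. by rewrite invr_gt0. Qed.
Let lo_hi n : lo n < hi n.
Proof.
rewrite (@lt_trans _ _ 1)//; first by rewrite invf_lt1// ltr1n.
by rewrite ltr1n.
Qed.

Lemma gamma_density_within x (a b : R) : 0 < a -> {within `[a, b], continuous (h x)}.
Proof.
move=> a0; apply: continuous_in_subspaceT => t; rewrite inE/= in_itv/= => /andP[at_ _].
exact/continuous_gamma_density/(lt_le_trans a0).
Qed.

Lemma integrable_gamma_density x (a b : R) : 0 < a ->
  mu.-integrable `[a, b] (EFin \o h x).
Proof.
move=> a0; apply: continuous_compact_integrable; first exact: segment_compact.
exact: gamma_density_within.
Qed.

(** Integration by parts, as the fundamental theorem of calculus for [h x], whose derivative is the
    difference of the two integrands. *)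
Lemma gamma_density_parts x (a b : R) : 0 < a -> a < b ->
  (x%:E * (\int[mu]_(t in `[a, b]) (h (x - 1) t)%:E) =
   \int[mu]_(t in `[a, b]) (h x t)%:E + (h x b - h x a)%:E)%E.
Proof.
move=> a0 ab.
have fin y : (\int[mu]_(t in `[a, b]) (h y t)%:E)%E \is a fin_num.
  exact: integrable_fin_num (integrable_gamma_density y b a0).
have : (\int[mu]_(t in `[a, b]) (x * h (x - 1) t - h x t)%:E =
        (h x b)%:E - (h x a)%:E)%E.
  have pos t : t \in `]a, b[ -> 0 < t.
    by rewrite in_itv/= => /andP[at_ _]; exact: lt_trans at_.
  apply: continuous_FTC2 => //.
  - apply: continuous_in_subspaceT => t; rewrite inE/= in_itv/= => /andP[at_ _].
    have t0 := lt_le_trans a0 at_.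
    have c1 := @continuous_gamma_density (x - 1) t t0.
    have c2 := @continuous_gamma_density x t t0.
    exact: (cvgB (cvgM (cvg_cst x) c1) c2).
  - split.
    + by move=> t /pos/(is_derive_gamma_density x)[].
    + apply: cvg_at_right_filter; exact: continuous_gamma_density.
    + by apply: cvg_at_left_filter; apply: continuous_gamma_density; exact: lt_trans ab.
  - move=> t /pos t0; rewrite derive1E.
    exact: (@derive_val _ _ _ _ _ _ _ (is_derive_gamma_density x t0)).
under eq_integral do rewrite EFinB EFinM.
rewrite integralB//=; last 2 first.
- by apply: integrableZl => //; exact: integrable_gamma_density.
- exact: integrable_gamma_density.
rewrite integralZl//; last exact: integrable_gamma_density.
move: (fin x) (fin (x - 1)).
case: (integral mu _ (fun t => (h x t)%:E)) => [A| |]// _.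
case: (integral mu _ (fun t => (h (x - 1) t)%:E)) => [B| |]// _.
rewrite -EFinB -EFinM -EFinB -EFinD => -[E].
by rewrite -E addrC subrK.
Qed.

Lemma gamma_density_exhaust y :
  (\int[mu]_(t in `[lo n, hi n]) (h y t)%:E @[n --> \oo] -->
   \int[mu]_(t in `]0%R, +oo[) (h y t)%:E)%E.
Proof.
pose g n t : \bar R := (((h y) \_ `[lo n, hi n]) t)%:E.
have gE n t : t \in `[lo n, hi n] -> g n t = (h y t)%:E.
  by move=> tn; rewrite /g patchE ifT// inE.
have g0 n t : (0 <= g n t)%E.
  by rewrite lee_fin patchE; case: ifP => // _; exact: gamma_density_ge0.
have mh (A : set R) : measurable A -> measurable_fun A (h y).
  by move=> mA; apply: measurable_funTS; exact: measurable_gamma_density.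
have mg (n : nat) : measurable_fun (`]0, +oo[%classic : set R) (g n).
  apply/measurable_EFinP; apply: measurable_funTS.
  by apply/(measurable_restrictT _ _).1 => //; exact: mh.
have ndg t : t \in `]0, +oo[ -> {homo g^~ t : n m / (n <= m)%N >-> (n <= m)%E}.
  move=> t0 n m nm; rewrite /g !patchE lee_fin.
  case: ifPn => [|_]; last by case: ifP => // _; exact: gamma_density_ge0.
  rewrite inE/= in_itv/= => /andP[t1 t2]; rewrite ifT// inE/= in_itv/=.
  rewrite (le_trans _ t1) ?(le_trans t2)// ?ler_nat//.
  by rewrite lef_pV2 ?posrE// ler_nat.
have lg t : t \in `]0, +oo[ -> limn (g^~ t) = (h y t)%:E.
  rewrite in_itv/= andbT => t0; apply: cvg_lim => //.
  apply: cvg_near_cst; near=> n; apply: gE.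
  rewrite in_itv/=; apply/andP; split.
  - rewrite /lo invf_ple ?posrE// (@le_trans _ _ n%:R) ?ler_nat ?leqW//.
    by near: n; exact: nbhs_infty_ger.
  - rewrite (@le_trans _ _ n%:R) ?ler_nat ?leqW//.
    by near: n; exact: nbhs_infty_ger.
have -> : (\int[mu]_(t in `]0%R, +oo[) (h y t)%:E)%E =
  (\int[mu]_(t in `]0%R, +oo[) limn (g^~ t))%E.
  by apply: eq_integral => t /set_mem/lg ->.
have -> : (fun n => (\int[mu]_(t in `[lo n, hi n]) (h y t)%:E)%E) =
   (fun n => (\int[mu]_(t in `]0%R, +oo[) g n t)%E).
  apply/funext => n.
  transitivity (\int[mu]_(t in `]0%R, +oo[) ((EFin \o h y) \_ `[lo n, hi n]) t)%E.
  2: by apply: eq_integral => t _; rewrite /g !patchE; case: ifP.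
  rewrite -integral_mkcondr.
  congr (integral _ _ _); apply/seteqP; split=> t /=; last by case.
  by rewrite !in_itv/= => /andP[t1 t2]; split; rewrite ?t1 ?t2 ?andbT ?(lt_le_trans _ t1).
exact: cvg_monotone_convergence.
Unshelve. all: by end_near. Qed.

(** In the extended reals the functional equation can be proved before finiteness is known, and then
    serves to establish it. *)
Definition eGamma x := (\int[mu]_(t in `]0%R, +oo[) (h (x - 1) t)%:E)%E.

Lemma GammaE x : Gamma x = fine (eGamma x).
Proof. by []. Qed.

Let lo_cvg0 : lo n @[n --> \oo] --> (0 : R).
Proof.
have := @cvg_harmonic R; rewrite -cvg_shiftS.
exact.
Qed.

Lemma gamma_density_lo x : 0 < x -> h x (lo n) @[n --> \oo] --> (0 : R).
Proof.
move=> x0; apply: (@squeeze_cvgr _ _ _ _ (cst 0) (fun n => lo n `^ x)).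
- apply: nearW => n; rewrite gamma_density_ge0 /= /h ler_piMr ?powR_ge0//.
  by rewrite -expR0 ler_expR oppr_le0 ltW.
- exact: cvg_cst.
have /cvgrPdist_lt H := powR_cvg0 x0.
apply/cvgrPdist_lt => e e0; have [r /= r0 Hr] := H e e0.
have /cvgrPdist_lt/(_ _ r0) Hlo := lo_cvg0.
by apply: filterS Hlo => n Hn; apply: Hr => //=; exact: lo_gt0.
Qed.

Lemma gamma_density_hi x : 0 < x -> h x (hi n) @[n --> \oo] --> (0 : R).
Proof.
move=> x0; pose m := Num.bound x.
(* Since x <= m, t^x <= t^m for t >= 1, while exp t >= t^(m+1) / (m+1)!; the quotient is at most
   (m+1)! / t. *)
apply: (@squeeze_cvgr _ _ _ _ (cst 0) (fun n => m.+1`!%:R * lo n)).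
- apply: nearW => n; rewrite gamma_density_ge0 /=.
  have n1 : 1 <= hi n by rewrite ler1n.
  have n0 : 0 < hi n by rewrite ltr0n.
  have xm : hi n `^ x <= hi n ^+ m.
    rewrite -(powR_mulrn _ (ltW n0)); apply: ler_powR => //.
    exact/ltW/archi_boundP/ltW.
  apply: le_trans (ler_wpM2r (expR_ge0 _) xm) _.
  have f0 : 0 < m.+1`!%:R :> R by rewrite ltr0n fact_gt0.
  have e1 : hi n ^+ m.+1 / m.+1`!%:R <= expR (hi n).
    by apply: le_trans (expR_ge1Dxn m (ltW n0)); rewrite lerDr.
  rewrite expRN ler_pdivrMr ?expR_gt0// mulrAC.
  rewrite ler_pdivlMr// -exprSr -ler_pdivrMl//.
  by rewrite mulrC.
- exact: cvg_cst.
- by rewrite -[X in _ --> X](mulr0 m.+1`!%:R); apply: cvgM => //; exact: cvg_cst.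
Qed.

(** Integration by parts on [[lo n], [hi n]], where both boundary terms vanish in the limit. *)
Lemma eGammaS x : 0 < x -> eGamma (x + 1) = (x%:E * eGamma x)%E.
Proof.
move=> x0; pose u n := (\int[mu]_(t in `[lo n, hi n]) (h x t)%:E)%E.
pose v n := (x%:E * \int[mu]_(t in `[lo n, hi n]) (h (x - 1) t)%:E)%E.
have vE : v = (fun n => u n + (h x (hi n) - h x (lo n))%:E)%E.
  by apply/funext => n; exact: gamma_density_parts.
have v1 : (v n @[n --> \oo] --> x%:E * eGamma x)%E.
  by apply: cvgeZl => //; exact: gamma_density_exhaust.
have v2 : (v n @[n --> \oo] --> eGamma (x + 1) + 0)%E.
  rewrite vE; apply: cvgeD.
  - by rewrite fin_num_adde_defl.
  - by rewrite /eGamma addrK; exact: gamma_density_exhaust.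
  - apply: cvg_EFin; first exact: nearW.
    rewrite -[X in _ --> X](subrr (0 : R)); apply: cvgB.
      exact: gamma_density_hi.
    exact: gamma_density_lo.
by rewrite -[LHS]adde0; exact: cvg_unique v2 v1.
Qed.

Lemma eGamma1 : eGamma 1 = 1%E.
Proof.
rewrite /eGamma subrr; under eq_integral do rewrite /h powRr0 mul1r.
rewrite integral_itv_obnd_cbnd; last first.
  apply/measurable_EFinP; apply: measurable_funTS.
  by apply: measurableT_comp => //; exact: measurable_expR.
rewrite (@ge0_continuous_FTC2y R (fun t => expR (- t)) (fun t => - expR (- t)) 0 0).
- by rewrite oppr0 expR0 sub0e -EFinN opprK.
- by move=> t _; exact: expR_ge0.
- apply: continuous_subspaceT => t.
  by apply: continuous_comp; [exact: opp_continuous|exact: continuous_expR].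
- rewrite -oppr0; apply: cvgN; exact: cvgr_expR.
- by move=> t t0; exact: ex_derive.
- apply: cvg_at_right_filter; apply: cvgN.
  by apply: continuous_comp; [exact: opp_continuous|exact: continuous_expR].
- move=> t _; rewrite derive1E.
  have d1 := @is_derive1_comp R expR -%R t (expR (- t)) (-1) (is_derive_expR _) (is_deriveNid t 1).
  rewrite (@derive_val _ _ _ _ _ _ _ (is_deriveN d1)).
  by rewrite mulrN1 opprK.
Qed.

Lemma eGamma_ge0 x : (0 <= eGamma x)%E.
Proof. by apply: integral_ge0 => t _; rewrite lee_fin gamma_density_ge0. Qed.

Lemma eGamma_fin_nat n : eGamma n.+1%:R \is a fin_num.
Proof.
elim: n => [|n IH]; first by rewrite eGamma1.
by rewrite -natr1 eGammaS// fin_numM.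
Qed.

(** By the functional equation it is enough to treat x + 1. There t^x <= 1 + t^m for an integer m >=
    x, so the integral is dominated by those at 1 and m + 1, both finite. *)
Lemma eGamma_fin x : 0 < x -> eGamma x \is a fin_num.
Proof.
move=> x0; suff : eGamma (x + 1) \is a fin_num.
  rewrite eGammaS//; have := eGamma_ge0 x; case: (eGamma x) => [r| |]// _.
  by rewrite gt0_muley ?lte_fin.
pose m := Num.bound x.
have m_fin := eGamma_fin_nat m.
rewrite ge0_fin_numE ?eGamma_ge0//.
apply: (@le_lt_trans _ _ (eGamma 1 + eGamma m.+1%:R)%E); last first.
  by rewrite eGamma1 lte_add_pinfty// ?ltry// -ge0_fin_numE// eGamma_ge0.
have mh y : measurable_fun (`]0, +oo[%classic : set R) (fun t => (h y t)%:E).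
  by apply/measurable_EFinP; apply: measurable_funTS; exact: measurable_gamma_density.
rewrite /eGamma -ge0_integralD//=.
- apply: ge0_le_integral => //=.
  + by move=> t _; rewrite lee_fin gamma_density_ge0.
  + exact: mh.
  + exact: emeasurable_funD (mh _) (mh _).
  move=> t; rewrite /= in_itv/= andbT => t0; rewrite -EFinD lee_fin /h.
  rewrite -mulrDl ler_wpM2r ?expR_ge0// addrK subrr powRr0 -natr1 addrK (powR_mulrn _ (ltW t0)).
  have [t1|t1] := leP t 1.
    apply: (@le_trans _ _ 1); last by rewrite lerDl exprn_ge0// ltW.
    apply: (@le_trans _ _ (1 `^ x)); last by rewrite powR1.
    by apply: ge0_ler_powR; rewrite ?nnegrE// ltW.
  apply: (@le_trans _ _ (t ^+ m)); last by rewrite lerDr.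
  rewrite -(powR_mulrn _ (ltW t0)); apply: ler_powR; first exact: ltW.
  exact/ltW/archi_boundP/ltW.
- by move=> t _; rewrite lee_fin gamma_density_ge0.
- exact: mh.
- by move=> t _; rewrite lee_fin gamma_density_ge0.
- exact: mh.
Qed.

Lemma Gamma_gt0 x : 0 < x -> 0 < Gamma x.
Proof.
move=> x0; rewrite GammaE fine_gt0// -ge0_fin_numE ?eGamma_ge0// eGamma_fin// andbT.
(* A lower bound of the integrand on [1, 2], for either sign of x - 1. *)
pose c := (2 `^ `|x - 1|)^-1 * expR (- 2).
have c0 : 0 < c by rewrite mulr_gt0 ?expR_gt0// invr_gt0 powR_gt0.
have mh : measurable_fun (`]0, +oo[%classic : set R) (fun t => (h (x - 1) t)%:E).
  by apply/measurable_EFinP; apply: measurable_funTS; exact: measurable_gamma_density.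
have sub : (`[1, 2]%classic : set R) `<=` `]0, +oo[%classic.
  by move=> t /=; rewrite !in_itv/= andbT => /andP[t1 _]; rewrite (lt_le_trans _ t1).
apply: (@lt_le_trans _ _ (\int[mu]_(t in `[1%R, 2%R]) c%:E)%E).
  rewrite integral_cst//= lebesgue_measure_itv/= lte_fin ltr1n/= -EFinB -EFinM lte_fin.
  by rewrite mulr_gt0// subr_gt0 ltr1n.
apply: (@le_trans _ _ (\int[mu]_(t in `[1%R, 2%R]) (h (x - 1) t)%:E)%E); last first.
  apply: ge0_subset_integral => //.
  by move=> t _; rewrite lee_fin gamma_density_ge0.
apply: ge0_le_integral => //=.
- by move=> t _; rewrite lee_fin ltW.
- exact: measurable_funS mh.
move=> t; rewrite in_itv/= => /andP[t1 t2]; rewrite lee_fin.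
have t0 : 0 < t by exact: lt_le_trans t1.
apply: ler_pM; rewrite ?invr_ge0 ?powR_ge0 ?expR_ge0 ?ler_expR ?lerN2//.
apply: (@le_trans _ _ (t `^ (- `|x - 1|))).
  rewrite powRN lef_pV2 ?posrE ?powR_gt0//.
  by apply: ge0_ler_powR; rewrite ?nnegrE// ltW.
by rewrite ler_powR// lerNl ler_normr lexx orbT.
Qed.

Lemma GammaS x : 0 < x -> Gamma (x + 1) = x * Gamma x.
Proof. by move=> x0; rewrite !GammaE eGammaS// fineM// eGamma_fin. Qed.

End GammaFunction.

(** * Coefficient identities *)

Section Factorials.
Variable R : numFieldType.
Implicit Types (x y h : R).

Definition poch x n : R := \prod_(k < n) (x + k%:R).
Definition falling x n : R := \prod_(k < n) (x - k%:R).

Lemma poch0 x : poch x 0 = 1. Proof. exact: big_ord0. Qed.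
Lemma pochS x n : poch x n.+1 = poch x n * (x + n%:R). Proof. exact: big_ord_recr. Qed.
Lemma falling0 x : falling x 0 = 1. Proof. exact: big_ord0. Qed.
Lemma fallingS x n : falling x n.+1 = falling x n * (x - n%:R). Proof. exact: big_ord_recr. Qed.

Lemma poch_gt0 x n : 0 < x -> 0 < poch x n.
Proof. by move=> x0; apply: prodr_gt0 => k _; rewrite ltr_wpDr. Qed.

Lemma fallingSl x n : falling x n.+1 = x * falling (x - 1) n.
Proof.
rewrite /falling big_ord_recl subr0; congr (_ * _).
by apply: eq_bigr => k _; rewrite /= /bump /= natrD opprD addrA.
Qed.

(** The last [k] factors of the rising factorial, read downwards. *)
Lemma poch_falling h n k : poch h (n + k) = poch h n * falling (h + (n + k)%:R - 1) k.
Proof.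
elim: k => [|k IH]; first by rewrite addn0 falling0 mulr1.
rewrite addnS pochS IH fallingSl -mulrA; congr (_ * _); rewrite mulrC.
by congr (_ * falling _ _); rewrite -natr1; ring.
Qed.

Lemma falling_nat N n : falling N%:R n = (N ^_ n)%:R.
Proof.
elim: n => [|n IH]; first by rewrite falling0 ffactn0.
rewrite fallingS IH ffactnSr natrM; have [nN|Nn] := leqP n N; first by rewrite natrB.
by rewrite ffact_small// !mul0r.
Qed.

Lemma falling_Vandermonde x y n :
  \sum_(i < n.+1) 'C(n, i)%:R * (falling x i * falling y (n - i)) = falling (x + y) n.
Proof.
elim: n => [|n IH]; first by rewrite big_ord1 bin0 mul1r !falling0 mulr1.
pose F i j := falling x i * falling y j.
(* The new factor splits as (x - i) + (y - j); Pascal's rule then recombines the terms. *)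
have FS i j : F i j * (x + y - (i + j)%:R) = F i.+1 j + F i j.+1.
  by rewrite /F !fallingS natrD; ring.
symmetry; rewrite fallingS -IH mulr_suml.
rewrite (eq_bigr (fun i : 'I_n.+1 => 'C(n, i)%:R * F i.+1 (n - i)%N + 'C(n, i)%:R * F i (n.+1 - i)%N)); last first.
  move=> i _; have ni : (i <= n)%N by rewrite -ltnS.
  rewrite -mulrA -[falling x i * _]/(F i (n - i)%N).
  have -> : x + y - n%:R = x + y - (i + (n - i))%:R by rewrite subnKC.
  by rewrite FS mulrDr -subSn.
rewrite big_split /= [RHS]big_ord_recl bin0 subn0.
under [in RHS]eq_bigr => i _ do rewrite /= /bump /= add1n binS subSS natrD mulrDl.
rewrite [in RHS]big_split /= addrA addrC; congr (_ + _).
rewrite big_ord_recl bin0 subn0 [in RHS]big_ord_recr /= bin_small// mul0r addr0.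
by congr (_ + _); apply: eq_bigr => i _; rewrite /bump /= add1n subSS.
Qed.

Local Notation f n := (n`!%:R : R).

Lemma fact_neq0 n : f n != 0.
Proof. by rewrite pnatr_eq0 -lt0n fact_gt0. Qed.

Lemma fact_natS n : f n.+1 = n.+1%:R * f n.
Proof. by rewrite factS natrM. Qed.

Lemma bin_nat n k : (k <= n)%N -> 'C(n, k)%:R = f n / (f k * f (n - k)) :> R.
Proof.
move=> kn; rewrite -(bin_fact kn) !natrM.
by rewrite mulfK// mulf_neq0 ?fact_neq0.
Qed.

Lemma poch_nat n k : poch n.+1%:R k = f (n + k) / f n.
Proof.
elim: k => [|k IH]; first by rewrite addn0 divff ?fact_neq0// poch0.
by rewrite pochS IH addnS fact_natS -natrD addSn mulrC mulrA.
Qed.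

(* The Chu-Vandermonde identity, once [1 / poch h (l + i)] is written as
   [falling x (j - i) / poch h (l + j)] with [x = h + l + j - 1]. *)
Lemma bessel_square_coef (D l j : nat) (h := D.+2%:R / 2) :
  \sum_(i < j.+1) (f i * poch h (l + i))^-1 * (f (j - i) * poch h (l + (j - i)))^-1 =
  'C(((l + j).*2 + D)%N, j)%:R / poch h (l + j) ^+ 2.
Proof.
have h0 : 0 < h by rewrite divr_gt0.
set m := (l + j)%N; pose x := h + m%:R - 1.
have x2 : x + x = (m.*2 + D)%:R.
  by rewrite /x /h -addnn !natrD -[D.+2]addn2 natrD; field.
have pm : poch h m != 0 by rewrite gt_eqF// poch_gt0.
have HH k i : (i + k = j)%N -> (poch h (l + i))^-1 = falling x k / poch h m.
  move=> ik; have := poch_falling h (l + i) k; rewrite -addnA ik -/m -/x => E.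
  have p1 : poch h (l + i) != 0 by rewrite gt_eqF// poch_gt0.
  by rewrite E; field; rewrite p1 andbT; apply: contra_neq pm; rewrite E => ->; rewrite mulr0.
have bE : 'C((m.*2 + D)%N, j)%:R = falling (x + x) j / f j.
  by rewrite x2 falling_nat -bin_ffact natrM mulfK ?fact_neq0.
rewrite bE -falling_Vandermonde !mulr_suml; apply: eq_bigr => i _.
have ij : (i <= j)%N by rewrite -ltnS.
rewrite !invfM (HH (j - i)%N i) ?subnKC// (HH i (j - i)%N) ?subnK//.
rewrite bin_nat//; field.
by rewrite pm !fact_neq0.
Qed.

(** Legendre's duplication formula: the factors of (2m + D)! / D! at alternate positions form the
    two Pochhammer symbols, up to a factor 2 each. *)
Lemma duplication (D m : nat) :
  4 ^+ m * poch (D.+2%:R / 2) m * poch (D.+1%:R / 2) m = f (m.*2 + D) / f D.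
Proof.
elim: m => [|m IH]; first by rewrite add0n !poch0 !mulr1 divff ?fact_neq0.
rewrite doubleS !addSn !fact_natS !pochS exprS.
transitivity (4 ^+ m * poch (D.+2%:R / 2) m * poch (D.+1%:R / 2) m *
   ((m.*2 + D).+2%:R * (m.*2 + D).+1%:R)); last by rewrite IH; field; rewrite fact_neq0.
by rewrite -!natr1 -addnn !natrD; field.
Qed.

(** * Alternating sums of dimensions and Legendre coefficients *)

Section Gegenbauer.
Variables (D : nat) (N : nat -> nat).
Hypothesis HN : forall l,
  (N l + 'C(l.-2 + D.+1, D.+1) * (1 < l) = 'C(l + D.+1, D.+1))%N.

(** The classical formula N_l = (2l + D) (l + D - 1)! / (l! D!), cleared of denominators. At l = D =
    0 its right-hand side would be 0, whereas N_0 = 1. *)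
Lemma harmonic_dimE l : (0 < l + D)%N ->
  (N l)%:R * f l * f D = (l.*2 + D)%:R * f (l + D).-1.
Proof.
move=> lD; have D1 : D.+1%:R != 0 :> R by rewrite pnatr_eq0.
have E : 'C(l + D.+1, D.+1)%:R * (f l * f D.+1) = f (l + D.+1).
  by rewrite bin_nat ?leq_addl// addnK; field; rewrite !fact_neq0.
have := congr1 (GRing.natmul 1 : nat -> R) (HN l); rewrite natrD => H.
apply: (mulIf D1); transitivity ((N l)%:R * (f l * f D.+1)).
  by rewrite fact_natS; ring.
case: l lD E H => [|[|l]] lD; rewrite ?muln0 ?addr0 ?muln1.
- rewrite !add0n => E ->; rewrite E fact_natS -[in f D](prednK (lD : (0 < D)%N)).
  by rewrite fact_natS prednK//; ring.
- by move=> E ->; rewrite E add1n /= !fact_natS !natrD -!natr1; ring.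
move: lD => _.
move=> E; rewrite -[l.+2.-2]/l => H; rewrite (_ : (N l.+2)%:R = 'C(l.+2 + D.+1, D.+1)%:R - 'C(l + D.+1, D.+1)%:R); last first.
  by rewrite -H addrK.
rewrite mulrBl E.
have -> : 'C(l + D.+1, D.+1)%:R * (f l.+2 * f D.+1) = l.+2%:R * l.+1%:R * f (l + D.+1) :> R.
  by rewrite bin_nat ?leq_addl// addnK !fact_natS; field; rewrite !fact_neq0 nat1r pnatr_eq0.
rewrite -[(l.+2 + D).-1]/(l + D).+1.
have -> : (l.+2.*2 + D)%:R = l%:R + l%:R + D%:R + 4 :> R.
  by rewrite -addnn !natrD -[l.+2]addn2 natrD; ring.
rewrite !addSn !addnS !fact_natS -!natr1 !natrD; ring.
Qed.

(** The part depending on l of N_l times the coefficient of (1 - t)^i in the Legendre polynomial of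
    degree l. *)
Definition gegenbauer_weight l i : R := (N l * 'C(l, i))%:R * poch (l + D)%:R i.
Local Notation W := gegenbauer_weight.

Lemma gegenbauer_weightE i a : (0 < a + i + D)%N ->
  W (a + i) i * f D * f i * f a = ((a + i).*2 + D)%:R * f (a + i.*2 + D).-1.
Proof.
move=> aiD; have := harmonic_dimE aiD.
rewrite /W natrM bin_nat ?leq_addl// addnK.
have -> : (a + i + D = (a + i + D).-1.+1)%N by rewrite prednK.
rewrite poch_nat /= => H.
have -> : (a + i.*2 + D).-1 = ((a + i + D).-1 + i)%N by lia.
transitivity ((N (a + i))%:R * f (a + i) * f D * (f ((a + i + D).-1 + i) / f (a + i + D).-1)).
  by field; rewrite !fact_neq0.
by rewrite H; field; rewrite fact_neq0.
Qed.

(** For [a = 0] the factor 2i + D merges into the factorial, and the resulting formula also covers i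
    = D = 0. *)
Lemma gegenbauer_weight_diag i : W i i * f D * f i = f (i.*2 + D).
Proof.
have [iD|] := posnP (i + D); last first.
  move=> iD; have := @gegenbauer_weightE i 0; rewrite !add0n => /(_ iD).
  rewrite mulr1 => ->; have -> : (i.*2 + D = (i.*2 + D).-1.+1)%N by lia.
  by rewrite fact_natS.
have [-> D0] : i = 0%N /\ D = 0%N by lia.
have := HN 0; rewrite muln0 addn0 add0n binn => N0.
by rewrite /W N0 D0 poch0 !mulr1.
Qed.

(* The alternating sum telescopes: its partial sums have a closed form. *)
Lemma gegenbauer_partial_sum i M a (m := (i + M.+1)%N) : (a <= M)%N ->
  (M.+1%:R * f D * f i) * (\sum_(l < (a + i).+1) (-1) ^+ l * 'C(m.*2 + D, m - l)%:R * W l i) =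
  (-1) ^+ (i + a) * f (m.*2 + D) * f (i.*2 + a + D) / (f a * f (M - a) * f (m + i + a + D)).
Proof.
have Wsmall l : (l < i)%N -> W l i = 0 by move=> li; rewrite /W bin_small// muln0 mul0r.
elim: a => [|a IH] aM.
  rewrite big_ord_recr /= big1 ?add0r => [|l _]; last by rewrite Wsmall ?mulr0.
  have := gegenbauer_weight_diag i; rewrite !addn0 subn0 => E.
  have -> : (m - i = M.+1)%N by rewrite /m addKn.
  rewrite bin_nat; last by lia.
  have -> : (m.*2 + D - M.+1 = m + i + D)%N by lia.
  rewrite !add0n -E fact_natS fact0; field.
  by rewrite !fact_neq0 nat1r pnatr_eq0.
rewrite addSn big_ord_recr /= mulrDr IH; last by lia.
have := @gegenbauer_weightE i a.+1; rewrite addSn => /(_ isT) E.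
have -> : W (a + i).+1 i = ((a + i).+1.*2 + D)%:R * f (a.+1 + i.*2 + D).-1 / (f D * f i * f a.+1).
  by rewrite -E; field; rewrite !fact_neq0.
rewrite bin_nat; last by lia.
have -> : (m - (a + i).+1 = M - a)%N by lia.
have -> : (m.*2 + D - (M - a) = (m + i + a + D).+1)%N by lia.
have -> : (a.+1 + i.*2 + D).-1 = (i.*2 + a + D)%N by lia.
have -> : (m + i + a.+1 + D = (m + i + a + D).+1)%N by lia.
have -> : (i.*2 + a.+1 + D = (i.*2 + a + D).+1)%N by lia.
(* This substitution removes all truncated subtractions, leaving an identity of rational
   functions. *)
have [b Mb] : exists b, (M = a + b.+1)%N by exists (M - a.+1)%N; lia.
have -> : (M - a = b.+1)%N by lia.
have -> : (M - a.+1 = b)%N by lia.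
have mE : m = (i + (a + b.+1).+1)%N by rewrite /m Mb.
rewrite !fact_natS.
have -> : (-1) ^+ (i + a.+1) = - (-1) ^+ (i + a) :> R by rewrite addnS exprS mulN1r.
have -> : (-1) ^+ (a + i).+1 = - (-1) ^+ (i + a) :> R by rewrite addnC exprS mulN1r.
have e1 : ((a + i).+1.*2 + D)%:R = 2 * (a%:R + i%:R + 1) + D%:R :> R.
  by rewrite -addnn !natrD -!natr1 !natrD; ring.
have e2 : (m + i + a + D).+1%:R = i%:R *+ 2 + a%:R *+ 2 + b%:R + D%:R + 3 :> R.
  by rewrite mE -natr1 !natrD -!natr1 !natrD -!natr1; ring.
have e3 : (i.*2 + a + D).+1%:R = i%:R *+ 2 + a%:R + D%:R + 1 :> R.
  by rewrite -addnn -natr1 !natrD; ring.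
have e4 : M.+1%:R = a%:R + b%:R + 2 :> R.
  by rewrite Mb -natr1 natrD -natr1; ring.
have := fact_neq0 D; have := fact_neq0 i; have := fact_neq0 a; have := fact_neq0 b.
have := fact_neq0 (m + i + a + D).
have : (m + i + a + D).+1%:R != 0 :> R by rewrite pnatr_eq0.
have : a.+1%:R != 0 :> R by rewrite pnatr_eq0.
have : b.+1%:R != 0 :> R by rewrite pnatr_eq0.
rewrite e1 e2 e3 e4 -!natr1; move: (f (m.*2 + D)) (f (m + i + a + D)) (f (i.*2 + a + D)).
move: (f a) (f b) (f i) (f D) => fa fb fi fD F1 F2 F3 *.
field; do ?[apply/andP; split=> //].
Qed.

Lemma gegenbauer_sum i m : (i <= m)%N ->
  \sum_(l < m.+1) (-1) ^+ l * 'C(m.*2 + D, m - l)%:R * W l i =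
  if i == m then (-1) ^+ m * W m m else 0.
Proof.
have Wsmall l : (l < i)%N -> W l i = 0 by move=> li; rewrite /W bin_small// muln0 mul0r.
rewrite leq_eqVlt => /predU1P[im|im].
  rewrite -im eqxx big_ord_recr /= big1 ?add0r => [|l _]; last by rewrite Wsmall ?mulr0.
  by rewrite subnn bin0 mulr1.
rewrite (ltn_eqF im).
(* The closed form at [a = M] covers exactly the indices l < m, and the term l = m is its opposite.
   Formally, the closed form at [a = M + 1] would contain 1 / (-1)! = 0. *)
pose M := (m - i).-1; have mE : m = (M + i).+1 by rewrite /M; lia.
have c0 : M.+1%:R * f D * f i != 0 by rewrite !mulf_neq0 ?fact_neq0// pnatr_eq0.
apply: (mulfI c0); rewrite mulr0 big_ord_recr /= mulrDr [in X in X + _]mE.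
have := @gegenbauer_partial_sum i M M (leqnn M).
have -> : (i + M.+1 = m)%N by lia.
rewrite -mE => ->; rewrite !subnn bin0 mulr1.
have := @gegenbauer_weightE i M.+1; have -> : (M.+1 + i = m)%N by lia.
move=> /(_ (ltac:(by rewrite mE))).
have -> : (M.+1 + i.*2 + D).-1 = (i.*2 + M + D)%N by lia.
move=> E.
have -> : W m i = (m.*2 + D)%:R * f (i.*2 + M + D) / (f D * f i * f M.+1).
  by rewrite -E; field; rewrite !fact_neq0.
have -> : (m.*2 + D = (m + i + M + D).+1)%N by lia.
have -> : (-1) ^+ m = - (-1) ^+ (i + M) :> R by rewrite mE exprS mulN1r addnC.
rewrite !fact_natS.
have := fact_neq0 D; have := fact_neq0 i; have := fact_neq0 M.
have := fact_neq0 (m + i + M + D).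
have : (m + i + M + D).+1%:R != 0 :> R by rewrite pnatr_eq0.
have : M.+1%:R != 0 :> R by rewrite pnatr_eq0.
move: ((_).+1%:R : R) ((_).+1%:R : R) => x y.
move: (f (m + i + M + D)) (f (i.*2 + M + D)).
move: (f M) (f i) (f D) => fM fi fD F1 F2 *.
field; do ?[apply/andP; split=> //].
Qed.

(* The two families of coefficients below are, up to a constant, those of
   [besselphi ^ 2] in powers of [z ^ 2] and those of the Legendre polynomial in
   powers of [1 - t]. *)
Definition square_coef m l : R :=
  4 ^- m * (-1) ^+ (m - l) * 'C(m.*2 + D, m - l)%:R / poch (D.+2%:R / 2) m ^+ 2.

Definition legendre_coef l i : R :=
  (-1) ^+ i * 2 ^- i * 'C(l, i)%:R * poch (l + D)%:R i / poch (D.+1%:R / 2) i.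

(** Factors depending on i and m alone come out of the sum, leaving [gegenbauer_sum]. In the
    surviving case i = m, the duplication formula expresses the weight by Pochhammer symbols, one of
    which cancels the denominator of the Legendre coefficient. *)
Lemma addition_coef i m : (i <= m)%N ->
  \sum_(l < m.+1) square_coef m l * (N l)%:R * legendre_coef l i =
  if i == m then (-1) ^+ m * 2 ^+ m / (4 ^+ m * f m * poch (D.+2%:R / 2) m) else 0.
Proof.
move=> im; set h : R := D.+2%:R / 2; set e : R := D.+1%:R / 2.
have ph : poch h m != 0 by rewrite gt_eqF// poch_gt0// divr_gt0.
have pe k : poch e k != 0 by rewrite gt_eqF// poch_gt0// divr_gt0.
transitivity ((4 ^- m * (-1) ^+ m / poch h m ^+ 2 * ((-1) ^+ i * 2 ^- i / poch e i)) *
  \sum_(l < m.+1) (-1) ^+ l * 'C(m.*2 + D, m - l)%:R * W l i).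
  rewrite mulr_sumr; apply: eq_bigr => l _.
  have lm : (l <= m)%N by rewrite -ltnS.
  have -> : square_coef m l = 4 ^- m * (-1) ^+ m * (-1) ^+ l * 'C(m.*2 + D, m - l)%:R / poch h m ^+ 2.
    rewrite /square_coef -/h -!mulrA; congr (_ * _); rewrite !mulrA; congr (_ * _ * _).
    by rewrite -signr_odd oddB// signr_addb !signr_odd.
  by rewrite /legendre_coef -/e /gegenbauer_weight natrM; ring.
rewrite gegenbauer_sum//; case: eqP => [->|_]; last by rewrite mulr0.
have E := gegenbauer_weight_diag m; have E2 := duplication D m; rewrite -/h -/e in E2.
have -> : W m m = 4 ^+ m * poch h m * poch e m / f m.
  by rewrite E2 -E; field; rewrite !fact_neq0.
have s1 : (-1) ^+ m * (-1) ^+ m = 1 :> R by rewrite -expr2 sqrr_sign.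
have p4 : 4 ^+ m = 2 ^+ m * 2 ^+ m :> R by rewrite -exprMn -natrM.
transitivity (((-1) ^+ m * (-1) ^+ m) * (-1) ^+ m * 2 ^- m / (f m * poch h m)).
  rewrite p4; have : 2 ^+ m != 0 :> R by rewrite expf_neq0// pnatr_eq0.
  have := fact_neq0 m; have := pe m; move: ph; clear.
  move: (poch h m) (poch e m) (f m) (2 ^+ m) ((-1) ^+ m) => a b c x s *.
  by field; do ?[apply/andP; split=> //].
rewrite s1 mul1r p4; have : 2 ^+ m != 0 :> R by rewrite expf_neq0// pnatr_eq0.
have := fact_neq0 m; move: ph; clear.
move: (poch h m) (f m) (2 ^+ m) ((-1) ^+ m) => a b x s *.
by field; do ?[apply/andP; split=> //].
Qed.

End Gegenbauer.
End Factorials.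

(** * Legendre polynomials *)

Section Legendre.
Variable R : realType.
Implicit Types (a s t : R).

Lemma Gamma_poch (x : R) n : 0 < x -> Gamma (x + n%:R) = poch x n * Gamma x.
Proof.
move=> x0; elim: n => [|n IH]; first by rewrite addr0 poch0 mul1r.
have xn : 0 < x + n%:R by exact: ltr_wpDr.
rewrite -natr1 addrA (GammaS xn) IH pochS; move: (Gamma x) => G; ring.
Qed.

(** Coefficient of (1 - t)^i in the polynomial p_k such that the k-th derivative of (1 - t^2)^a is
    (1 - t^2)^(a - k) p_k(t). *)
Definition rodrigues_coef a k i : R :=
  (-1) ^+ (k + i) * 2 ^+ (k - i) * 'C(k, i)%:R * falling a (k - i) * poch (2 * a - k%:R + 1) i.

Lemma rodrigues_coef0 a k : rodrigues_coef a k.+1 0 = - 2 * (a - k%:R) * rodrigues_coef a k 0.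
Proof.
rewrite /rodrigues_coef !addn0 !subn0 !bin0 !poch0 fallingS !exprS; ring.
Qed.

Lemma rodrigues_coefS a k i : (i <= k)%N -> rodrigues_coef a k.+1 i.+1 =
  - 2 * (a - k%:R + i.+1%:R) * rodrigues_coef a k i.+1 +
  (i%:R + 2 * (a - k%:R)) * rodrigues_coef a k i.
Proof.
move=> ik; rewrite /rodrigues_coef.
set X := poch (2 * a - k%:R + 1) i.
have X1 : poch (2 * a - k.+1%:R + 1) i.+1 = (2 * a - k%:R) * X.
  have := poch_falling (2 * a - k.+1%:R + 1) 1 i; rewrite add1n [poch _ 1]pochS poch0 mul1r addr0 => ->.
  have := poch_falling (2 * a - k%:R + 1) 0 i; rewrite add0n poch0 mul1r /X => ->.
  by rewrite -!natr1; congr (_ * falling _ _); ring.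
have X2 : poch (2 * a - k%:R + 1) i.+1 = X * (2 * a - k%:R + 1 + i%:R) by rewrite pochS.
have S1 : (-1) ^+ (k.+1 + i.+1) = (-1) ^+ (k + i) :> R by rewrite addSn addnS !exprS; ring.
have S2 : (-1) ^+ (k + i.+1) = - (-1) ^+ (k + i) :> R by rewrite addnS exprS mulN1r.
rewrite X1 X2 S1 S2 subSS.
have [ik'|ik'] := ltnP i k; last first.
  have -> : k = i by apply/eqP; rewrite eqn_leq ik ik'.
  by rewrite subnn (bin_small (ltnSn i)) !binn falling0; ring.
have [j kE] : exists j, (k - i = j.+1)%N by exists (k - i).-1; rewrite prednK// subn_gt0.
have kE' : (k - i.+1 = j)%N by rewrite subnS kE.
have kR : k%:R = i%:R + j%:R + 1 :> R by rewrite -(subnKC ik) kE natrD -natr1 addrA.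
have B1 : i.+1%:R * 'C(k, i.+1)%:R = j.+1%:R * 'C(k, i)%:R :> R.
  by rewrite -!natrM mul_bin_left kE.
have B2 : 'C(k, i.+1)%:R = j.+1%:R / i.+1%:R * 'C(k, i)%:R :> R.
  have i0 : i.+1%:R != 0 :> R by rewrite pnatr_eq0.
  by apply: (mulfI i0); rewrite B1; field; rewrite nat1r.
have i0 : i.+1%:R != 0 :> R by rewrite pnatr_eq0.
rewrite kE kE' binS natrD B2 fallingS exprS kR.
rewrite -!natr1 in i0 *.
by field.
Qed.

Definition rodrigues_poly a k : {poly R} :=
  \sum_(i < k.+1) rodrigues_coef a k i *: (1 - 'X) ^+ i.

(** This is the product rule for (1 - t^2)^(a - k) p_k(t) after division by (1 - t^2)^(a - k -
    1). *)
Lemma rodrigues_polyS a k : rodrigues_poly a k.+1 =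
  (1 - 'X ^+ 2) * (rodrigues_poly a k)^`() - (2 * (a - k%:R)) *: ('X * rodrigues_poly a k).
Proof.
pose u : {poly R} := 1 - 'X.
have XE : 'X = 1 - u by rewrite /u opprB addrC subrK.
have uD i : (1 - 'X ^+ 2) * (u ^+ i)^`() = i%:R *: (u ^+ i.+1 - 2 *: u ^+ i).
  rewrite deriv_exp /u derivB derivX derivC -/u sub0r.
  case: i => [|i]; first by rewrite mulr0n mulr0 scale0r.
  rewrite -mulr_natr /= XE !exprS -!mul_polyC polyC_natr; ring.
rewrite /rodrigues_poly raddf_sum !mulr_sumr scaler_sumr -sumrB /=.
pose c := rodrigues_coef a k.
have E (i : 'I_k.+1) : (1 - 'X ^+ 2) * (c i *: u ^+ i)^`() - (2 * (a - k%:R)) *: ('X * (c i *: u ^+ i)) =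
   (- 2 * (a - k%:R + i%:R) * c i) *: u ^+ i + ((i%:R + 2 * (a - k%:R)) * c i) *: u ^+ i.+1.
  rewrite derivZ -scalerAr uD XE exprS -!mul_polyC.
  by rewrite !(polyCM, polyCD, polyCN); ring.
rewrite [RHS](eq_bigr _ (fun i _ => E i)) big_split /= big_ord_recl rodrigues_coef0.
rewrite [X in _ = X + _]big_ord_recl addr0 -addrA; congr (_ + _).
have E2 (i : 'I_k.+1) : xpredT i ->
    rodrigues_coef a k.+1 (lift ord0 i) *: u ^+ lift ord0 i =
    (- 2 * (a - k%:R + i.+1%:R) * c i.+1) *: u ^+ i.+1 + ((i%:R + 2 * (a - k%:R)) * c i) *: u ^+ i.+1.
  by move=> _; rewrite lift0 rodrigues_coefS ?scalerDl// -ltnS.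
rewrite [LHS](eq_bigr _ E2).
rewrite big_split /=; congr (_ + _).
rewrite big_ord_recr /= /c /rodrigues_coef bin_small// mulr0 !mul0r mulr0 scale0r addr0.
by apply: eq_bigr => i _; rewrite /bump /= add1n.
Qed.

Lemma is_derive_powR_onem_sqr a t : -1 < t < 1 ->
  is_derive t 1 (fun s : R => (1 - s ^+ 2) `^ a) (- 2 * a * t * (1 - t ^+ 2) `^ (a - 1)).
Proof.
move=> /andP[t1 t2]; have u0 : 0 < 1 - t ^+ 2 by nra.
have d1 : is_derive t 1 (fun s : R => 1 - s ^+ 2) (- 2 * t).
  pose p : {poly R} := 1 - 'X^2.
  have := @is_derive_poly R p t.
  have -> : horner p = (fun s => 1 - s ^+ 2) by apply/funext => s; rewrite !hornerE.
  rewrite /p derivB derivC derivXn !hornerE.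
  by move=> d; apply: (is_derive_eq d); ring.
have := @is_derive1_comp R (@powR R ^~ a) (fun s => 1 - s ^+ 2) t _ _ (is_derive1_powR a u0) d1.
by move=> d; apply: (is_derive_eq d); ring.
Qed.

Lemma derive1n_powR_onem_sqr a k t : -1 < t < 1 ->
  derive1n k (fun s : R => (1 - s ^+ 2) `^ a) t =
  (1 - t ^+ 2) `^ (a - k%:R) * (rodrigues_poly a k).[t].
Proof.
elim: k t => [|k IH] t t1.
  rewrite derive1n0 subr0 /rodrigues_poly big_ord1 /rodrigues_coef !expr0.
  by rewrite bin0 falling0 poch0 !mul1r scale1r hornerC mulr1.
rewrite derive1nS derive1E.
have /andP[t2 t3] := t1; have u0 : 0 < 1 - t ^+ 2 by nra.
(* The induction hypothesis holds on the open interval only, which suffices for a derivative. *)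
have near_t : \near t, derive1n k (fun s : R => (1 - s ^+ 2) `^ a) t =
   (1 - t ^+ 2) `^ (a - k%:R) * (rodrigues_poly a k).[t].
  near=> s; apply: IH; apply/andP; split; near: s; [exact: lt_nbhsr|exact: lt_nbhsl].
rewrite (near_eq_derive _ near_t) ?oner_neq0//.
have d1 := is_derive_powR_onem_sqr (a - k%:R) t1.
have d2 := @is_derive_poly R (rodrigues_poly a k) t.
have d3 := is_deriveM d1 d2.
rewrite (@derive_val _ _ _ _ _ _ _ d3) /GRing.scale/= rodrigues_polyS.
rewrite !(hornerD, hornerN, hornerM, hornerZ, horner_exp, hornerX, hornerC).
have -> : (1 - t ^+ 2) `^ (a - k%:R) = (1 - t ^+ 2) `^ (a - k.+1%:R) * (1 - t ^+ 2).
  rewrite -[X in _ = _ * X](powRr1 (ltW u0)) -powRD; last by rewrite (gt_eqF u0) implybT.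
  by congr (_ `^ _); rewrite -natr1; ring.
have -> : a - k%:R - 1 = a - k.+1%:R by rewrite -natr1; ring.
ring.
Unshelve. all: by end_near. Qed.

Lemma poly_unique_itv (p q : {poly R}) :
  (forall t, -1 < t < 1 -> p.[t] = q.[t]) -> p = q.
Proof.
move=> H; apply/eqP; rewrite -subr_eq0; apply/eqP.
apply: (@roots_geq_poly_eq0 _ _ [seq n.+2%:R^-1 | n <- iota 0 (size (p - q))]).
- apply/allP => _ /mapP[n _ ->]; rewrite /root hornerD hornerN subr_eq0; apply/eqP/H.
  by rewrite invf_lt1// ltr1n andbT (@lt_trans _ _ 0).
- rewrite map_inj_uniq ?iota_uniq// => m n /eqP.
  by rewrite (inj_eq invr_inj) eqr_nat => /eqP[].
- by rewrite size_map size_iota.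
Qed.

(** The l-fold derivative leaves the power (1 - t^2)^b with b = (d - 3) / 2, which the prefactor of
    the Rodrigues formula cancels. A polynomial is determined by its values on ]-1, 1[, so [xget]
    can only return this one. *)
Lemma legendreE (D l : nat) : legendre R D.+2 l =
  \sum_(i < l.+1) legendre_coef R D l i *: (1 - 'X) ^+ i.
Proof.
set L := RHS.
have HL t : -1 < t < 1 -> L.[t] = rodrigues D.+2 l t.
  move=> t1; have /andP[t2 t3] := t1; have u0 : 0 < 1 - t ^+ 2 by nra.
  rewrite /rodrigues derive1n_powR_onem_sqr//.
  set b : R := (D.+2%:R - 3) / 2; set e : R := (D.+2%:R - 1) / 2.
  have eE : e = D.+1%:R / 2 by rewrite /e -!natr1; field.
  have e0 : 0 < e by rewrite eE divr_gt0.
  have -> : l%:R + b - l%:R = b by ring.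
  rewrite powRN addrC Gamma_poch// mulrA -[X in _ = X * _]mulrA mulVf ?mulr1; last by rewrite gt_eqF// powR_gt0.
  have G0 : Gamma e != 0 by rewrite gt_eqF// Gamma_gt0.
  have pe k : poch e k != 0 by rewrite gt_eqF// poch_gt0.
  rewrite /L /rodrigues_poly !horner_sum mulr_sumr; apply: eq_bigr => i _.
  rewrite !hornerZ mulrA; congr (_ * _).
  have il : (i <= l)%N by rewrite -ltnS.
  rewrite /legendre_coef /rodrigues_coef -eE.
  have -> : 2 * (l%:R + b) - l%:R + 1 = (l + D)%:R.
    by rewrite /b natrD -!natr1; field.
  (* Because e + l - 1 = l + b, the quotient of [poch e l] by [poch e i] is the falling factorial of
     [rodrigues_coef]. *)
  have pE := poch_falling e i (l - i); rewrite subnKC// in pE.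
  have aE : e + l%:R - 1 = l%:R + b by rewrite /e /b; field.
  rewrite aE in pE.
  have pl := pe l; rewrite pE mulf_eq0 negb_or in pl; case/andP: pl => pi pf.
  rewrite pE; have -> : 2 ^+ l = 2 ^+ i * 2 ^+ (l - i) :> R by rewrite -exprD subnKC.
  have -> : (-1) ^+ (l + i) = (-1) ^+ l * (-1) ^+ i :> R by rewrite exprD.
  have s1 : (-1) ^+ l * (-1) ^+ l = 1 :> R by rewrite -expr2 sqrr_sign.
  have x0 : 2 ^+ i != 0 :> R by rewrite expf_neq0// pnatr_eq0.
  have y0 : 2 ^+ (l - i) != 0 :> R by rewrite expf_neq0// pnatr_eq0.
  rewrite -[LHS]mul1r -[X in X * _ = _]s1; move: G0 pi pf x0 y0; clear.
  move: (Gamma e) (poch e i) (falling _ _) (2 ^+ i) (2 ^+ (l - i)) => G p F x y.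
  move: ((-1) ^+ l) ((-1) ^+ i) => *.
  by field; do ?[apply/andP; split=> //].
rewrite /legendre; case: xgetP => [p _ Hp|/(_ L) []//].
by apply: poly_unique_itv => t t1; rewrite Hp// HL.
Qed.

End Legendre.

(** * Complex series *)

Section ComplexSeries.
Variable R : realType.
Implicit Types (u v a : nat -> R[i]^o) (z : R[i]).

(** The norm of [R[i]] has values in [R[i]] itself; bounds are stated in the totally ordered field
    [R]. *)
Definition modulus z : R := complex.Re `|z|.

Lemma modulusE z : `|z| = (modulus z)%:C.
Proof. by rewrite /modulus normc_def. Qed.

Lemma modulus_ge0 z : 0 <= modulus z.
Proof. by rewrite -lecR -modulusE; exact: (normr_ge0 z). Qed.

Lemma modulusM z1 z2 : modulus (z1 * z2) = modulus z1 * modulus z2.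
Proof. by apply: complexI; rewrite /= rmorphM /= -!modulusE normrM. Qed.

Lemma modulusX z n : modulus (z ^+ n) = modulus z ^+ n.
Proof. by apply: complexI; rewrite /= rmorphXn /= -!modulusE normrX. Qed.

Lemma modulusV z : modulus z^-1 = (modulus z)^-1.
Proof. by apply: complexI; rewrite /= fmorphV /= -!modulusE normfV. Qed.

Lemma modulus_real (x : R) : modulus x%:C = `|x|.
Proof. by rewrite /modulus normc_real. Qed.

Lemma modulusD z1 z2 : modulus (z1 + z2) <= modulus z1 + modulus z2.
Proof. by rewrite -lecR rmorphD /= -!modulusE ler_normD. Qed.

Lemma modulusB z1 z2 : modulus (z1 - z2) = modulus (z2 - z1).
Proof. by rewrite /modulus distrC. Qed.

Lemma modulus_sum (I : Type) (r : seq I) (F : I -> R[i]) :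
  modulus (\sum_(i <- r) F i) <= \sum_(i <- r) modulus (F i).
Proof.
rewrite -lecR rmorph_sum /= -modulusE.
apply: le_trans (ler_norm_sum _ _ _) _.
by apply: ler_sum => i _; rewrite modulusE.
Qed.

Lemma modulus_eq0 z : (modulus z == 0) = (z == 0).
Proof. by rewrite -(inj_eq (@complexI R)) -modulusE normr_eq0. Qed.

Lemma modulus_Re z : `|complex.Re z| <= modulus z.
Proof. by rewrite -lecR -modulusE normc_ge_Re. Qed.

Lemma modulus_Im z : `|complex.Im z| <= modulus z.
Proof.
rewrite /modulus normc_def /= -sqrtr_sqr ler_sqrt ?addr_ge0 ?sqr_ge0//.
by rewrite lerDr sqr_ge0.
Qed.

Lemma modulus_le z : modulus z <= `|complex.Re z| + `|complex.Im z|.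
Proof.
case: z => a b; have -> : a +i* b = a%:C + 'i * b%:C by simpc.
apply: le_trans (modulusD _ _) _; rewrite modulusM !modulus_real /=.
have -> : modulus 'i = 1 by rewrite /modulus normc_def /= expr0n expr1n add0r sqrtr1.
by rewrite mul1r; simpc.
Qed.

Lemma cvgn_modulusP u (l : R[i]) : (u @ \oo --> (l : R[i]^o)) <->
  (forall e : R, 0 < e -> exists N, forall n, (N <= n)%N -> modulus (u n - l) < e).
Proof.
split=> [/cvgrPdist_lt H e e0|H].
  have [N _ HN] := H e%:C (ltac:(by rewrite ltcR)).
  by exists N => n Nn; have := HN n Nn; rewrite distrC modulusE ltcR.
apply: cvgn_complexP => e /H[N HN]; exists N => n /HN.
by rewrite modulusE ltcR.
Qed.

Lemma cvgn_ReIm u (x y : R) :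
  (fun n => complex.Re (u n)) @ \oo --> x -> (fun n => complex.Im (u n)) @ \oo --> y ->
  u @ \oo --> (x +i* y : R[i]^o).
Proof.
move=> /cvgrPdist_lt Hx /cvgrPdist_lt Hy; apply/cvgn_modulusP => e e0.
have e2 : 0 < e / 2 by rewrite divr_gt0.
have [N1 _ H1] := Hx _ e2; have [N2 _ H2] := Hy _ e2.
exists (maxn N1 N2) => n; rewrite geq_max => /andP[n1 n2].
have := H1 n n1; have := H2 n n2; rewrite /= ![`|_ - complex.Re _|]distrC ![`|_ - complex.Im _|]distrC => h2 h1.
apply: le_lt_trans (modulus_le _) _.
rewrite (splitr e) (_ : complex.Re (u n - _) = complex.Re (u n) - x); last by case: (u n).
rewrite (_ : complex.Im (u n - _) = complex.Im (u n) - y); last by case: (u n).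
exact: ltrD.
Qed.

Lemma Re_sum (I : Type) (r : seq I) (F : I -> R[i]) :
  complex.Re (\sum_(i <- r) F i) = \sum_(i <- r) complex.Re (F i).
Proof. by elim/big_rec2: _ => // i x y _ <-; case: (F i) => ? ?; case: y. Qed.

Lemma Im_sum (I : Type) (r : seq I) (F : I -> R[i]) :
  complex.Im (\sum_(i <- r) F i) = \sum_(i <- r) complex.Im (F i).
Proof. by elim/big_rec2: _ => // i x y _ <-; case: (F i) => ? ?; case: y. Qed.

Lemma cvgn_series_ReIm a (x y : R) :
  series (fun n => complex.Re (a n)) @ \oo --> x ->
  series (fun n => complex.Im (a n)) @ \oo --> y ->
  series a @ \oo --> (x +i* y : R[i]^o).
Proof.
move=> Hx Hy; apply: cvgn_ReIm.
- by under eq_fun do rewrite /series /= Re_sum.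
- by under eq_fun do rewrite /series /= Im_sum.
Qed.

Lemma complex_geometric_cvg a (C : R) : (forall n, modulus (a n) <= C * 2^-1 ^+ n) ->
  cvgn (series a).
Proof.
move=> H; have HR : cvgn (series (fun n => complex.Re (a n))).
  by apply: (@geometric_majorant_cvg _ _ C) => n; exact: le_trans (modulus_Re _) (H n).
have HI : cvgn (series (fun n => complex.Im (a n))).
  by apply: (@geometric_majorant_cvg _ _ C) => n; exact: le_trans (modulus_Im _) (H n).
by apply/cvg_ex; eexists; exact: (cvgn_series_ReIm HR HI).
Qed.

Lemma complex_geometric_lim a (C : R) m : (forall n, modulus (a n) <= C * 2^-1 ^+ n) ->
  (forall n, (n < m)%N -> a n = 0) ->
  modulus (limn (series a)) <= 2 * C * 2^-1 ^+ m.
Proof.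
move=> H Hm; have /cvgn_modulusP ca : series a @ \oo --> limn (series a) := complex_geometric_cvg H.
apply/ler_addgt0Pl => e e0; have [N /(_ N (leqnn N)) HN] := ca e e0.
rewrite (_ : limn (series a) = (limn (series a) - series a N) + series a N); last by rewrite subrK.
apply: le_trans (modulusD _ _) _; apply: lerD; first by rewrite modulusB ltW.
apply: le_trans (modulus_sum _ _) _.
rewrite (eq_bigr (fun k => `|modulus (a k)|)) => [|k _]; last by rewrite ger0_norm// modulus_ge0.
apply: geometric_majorant_sum => [n|n nm]; first by rewrite ger0_norm ?modulus_ge0.
by rewrite Hm// -[0]/(0%:C) modulus_real normr0.
Qed.

Lemma natr_le_exp2 n : n.+1%:R <= 2 ^+ n :> R.
Proof. by rewrite -natrX ler_nat ltn_expl. Qed.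

Lemma complex_lim u (l : R[i]^o) : u @ \oo --> l -> limn u = l.
Proof. exact: (cvg_lim (@norm_hausdorff _ _)). Qed.

Lemma complex_cvg_near u v (l : R[i]^o) N : u @ \oo --> l ->
  (forall n, (N <= n)%N -> v n = u n) -> v @ \oo --> l.
Proof.
move=> /cvgn_modulusP H E; apply/cvgn_modulusP => e /H[M HM].
by exists (maxn N M) => n; rewrite geq_max => /andP[nN nM]; rewrite E//; exact: HM.
Qed.

Lemma complex_cvgD u v (l1 l2 : R[i]^o) : u @ \oo --> l1 -> v @ \oo --> l2 ->
  (fun n => u n + v n) @ \oo --> l1 + l2.
Proof. by move=> ul vl; exact: (cvgD ul vl). Qed.

Lemma complex_cvgBc u (l x : R[i]^o) : u @ \oo --> l -> (fun n => u n - x) @ \oo --> l - x.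
Proof. by move=> ul; exact: (cvgB ul (cvg_cst x)). Qed.

Lemma complex_cvgMc u (l x : R[i]^o) : u @ \oo --> l -> (fun n => x * u n) @ \oo --> x * l.
Proof. by move=> ul; exact: (cvgM (cvg_cst x) ul). Qed.

Lemma complex_cvg_sum (I : Type) (r : seq I) (F : I -> nat -> R[i]^o) (L : I -> R[i]^o) :
  (forall i, F i @ \oo --> L i) ->
  (fun n => \sum_(i <- r) F i n) @ \oo --> (\sum_(i <- r) L i).
Proof.
move=> H; elim: r => [|i r IH].
  rewrite big_nil (_ : (fun n => _) = cst 0); first exact: cvg_cst.
  by apply/funext => n; rewrite big_nil.
rewrite big_cons (_ : (fun n => _) = F i \+ (fun n => \sum_(i <- r) F i n)).
  exact: cvgD (H i) IH.
by apply/funext => n; rewrite big_cons.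
Qed.

Lemma complex_series_shift u (x : R[i]^o) l : cvgn (series u) ->
  series (fun m => if (m < l)%N then 0 else x * u (m - l)%N : R[i]^o) @ \oo -->
  x * limn (series u).
Proof.
move=> cu; rewrite -(cvg_shiftn l).
apply: (complex_cvg_near (N := 0) (complex_cvgMc (x := x) cu)) => n _.
symmetry; rewrite /series /= (big_cat_nat (leq0n l) (leq_addl n l)) /=.
rewrite [X in _ = X + _]big1_seq ?add0r => [|m]; last first.
  by rewrite mem_index_iota => /andP[_ /andP[_ ->]].
rewrite mulr_sumr -{1}[l]add0n big_addn addnK; apply: eq_bigr => m _.
by rewrite ltnNge leq_addl /= addnK.
Qed.

(** * Summation of a triangular double series by columns *)

Section Triangular.
Variables (a : nat -> nat -> R[i]^o) (C : R).
Hypothesis a_bound : forall l m, modulus (a l m) <= C * 4^-1 ^+ m.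
Hypothesis a_triangular : forall l m, (m < l)%N -> a l m = 0.

Let C0 : 0 <= C.
Proof. by have := le_trans (modulus_ge0 _) (a_bound 0 0); rewrite mulr1. Qed.

Let quarter_half n : (4^-1 : R) ^+ n = 2^-1 ^+ n * 2^-1 ^+ n.
Proof. by rewrite -exprMn; congr (_ ^+ _); field. Qed.

Let half_ge0 n : 0 <= (2^-1 : R) ^+ n.
Proof. by rewrite exprn_ge0// invr_ge0. Qed.

Lemma triangular_row_bound l m : modulus (a l m) <= C * 2^-1 ^+ m.
Proof.
apply: le_trans (a_bound l m) _; rewrite ler_wpM2l// quarter_half ler_piMr//.
by rewrite exprn_ile1// ?invr_ge0// invf_le1// ler1n.
Qed.

Lemma triangular_row_lim l : modulus (limn (series (a l))) <= 2 * C * 2^-1 ^+ l.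
Proof.
apply: complex_geometric_lim; first exact: triangular_row_bound.
by move=> m ml; exact: a_triangular.
Qed.

(** At most m + 1 <= 2^m entries of size C 4^-m. *)
Lemma triangular_col_bound n m : (n <= m.+1)%N ->
  modulus (\sum_(l < n) a l m) <= C * 2^-1 ^+ m.
Proof.
move=> nm; apply: le_trans (modulus_sum _ _) _.
apply: (@le_trans _ _ (\sum_(l < n) C * 4^-1 ^+ m)).
  by apply: ler_sum => l _; exact: a_bound.
rewrite sumr_const card_ord -[_ *+ n]mulr_natr -mulrA ler_wpM2l// quarter_half -mulrA ler_piMr//.
apply: (@le_trans _ _ (2^-1 ^+ m * 2 ^+ m)).
  by rewrite ler_wpM2l// (le_trans _ (natr_le_exp2 m))// ler_nat.
by rewrite -exprMn mulVf ?expr1n.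
Qed.

(** The first N rows contain the columns m < N in full, by triangularity. The rest of these rows
    lies in columns m >= N and contributes at most 2 C 2^-N. *)
Lemma triangular_series :
  series (fun l => limn (series (a l)) : R[i]^o) @ \oo -->
  limn (series (fun m => \sum_(l < m.+1) a l m : R[i]^o)).
Proof.
pose c m : R[i]^o := \sum_(l < m.+1) a l m.
have cc : series c @ \oo --> limn (series c).
  by apply: (@complex_geometric_cvg _ C) => m; exact: triangular_col_bound.
have key N : modulus (series (fun l => limn (series (a l)) : R[i]^o) N - series c N) <=
    2 * C * 2^-1 ^+ N.
  (* What remains of the first [N] rows once the first [N] complete columns are removed. *)
  pose b m : R[i]^o := if (m < N)%N then 0 else \sum_(l < N) a l m.
  have bb m : modulus (b m) <= C * 2^-1 ^+ m.
    rewrite /b; case: ltnP => [_|Nm]; last exact/triangular_col_bound/leqW.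
    by rewrite -[0]/(0%:C) modulus_real normr0 mulr_ge0.
  have -> : series (fun l => limn (series (a l)) : R[i]^o) N - series c N = limn (series b).
    apply/esym/complex_lim.
    have c1 : (fun n => \sum_(l < N) series (a l) n) @ \oo --> (\sum_(l < N) limn (series (a l)) : R[i]^o).
      apply: (@complex_cvg_sum _ _ (fun l : 'I_N => series (a l)) (fun l : 'I_N => limn (series (a l)))) => l.
      exact: (@complex_geometric_cvg (a l) C (triangular_row_bound l)).
    rewrite {2}/series /= big_mkord.
    apply: (complex_cvg_near (N := N) (complex_cvgBc (x := series c N) c1)) => n Nn.
    symmetry; rewrite /series /=.
    rewrite exchange_big /= (big_cat_nat (leq0n N) Nn) [in RHS](big_cat_nat (leq0n N) Nn) /=.
    rewrite [X in _ = X + _]big1_seq ?add0r => [|m]; last first.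
      by rewrite mem_index_iota /b => /andP[_ /andP[_ ->]].
    rewrite addrAC [X in X + _](_ : _ = 0) ?add0r; last first.
      apply/eqP; rewrite subr_eq0; apply/eqP; apply: eq_big_nat => m /andP[_ mN].
      rewrite /c -(big_mkord xpredT (fun l => a l m)) -(big_mkord xpredT (fun l => a l m)).
      rewrite (big_cat_nat (leq0n m.+1) mN) /= [X in _ + X]big1_seq ?addr0// => l.
      by rewrite mem_index_iota => /andP[_ /andP[ml _]]; exact: a_triangular.
    by apply: eq_big_nat => m /andP[Nm _]; rewrite /b ltnNge Nm.
  by apply: complex_geometric_lim => // n nN; rewrite /b nN.
apply/cvgn_modulusP => e e0.
have e2 : 0 < e / 2 by rewrite divr_gt0.
have [N1 H1] := (cvgn_modulusP _ _).1 cc _ e2.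
have h1 : `|2^-1 : R| < 1 by rewrite ger0_norm ?invr_ge0// invf_lt1// ltr1n.
have /cvgrPdist_lt/(_ _ e2)[N2 _ H2] := cvg_geometric (2 * C) h1.
exists (maxn N1 N2) => n; rewrite geq_max => /andP[n1 n2].
rewrite -(subrKA (series c n)) (splitr e) (le_lt_trans (modulusD _ _))// ltrD//; last exact: H1.
apply: le_lt_trans (key n) _.
by have := H2 n n2; rewrite sub0r normrN /=; apply: le_lt_trans; exact: ler_norm.
Qed.

Lemma triangular_normed_series :
  cvgn [normed series (fun l => limn (series (a l)) : R[i]^o)].
Proof.
apply: (@complex_geometric_cvg _ (2 * C)) => n /=.
by rewrite modulusE modulus_real ger0_norm ?modulus_ge0// triangular_row_lim.
Qed.

End Triangular.

(** * Cauchy products as triangular double series *)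

Section CauchyProduct.
Variables (u v : nat -> R[i]^o) (Cu Cv : R).
Hypothesis u_bound : forall n, modulus (u n) <= Cu * 4^-1 ^+ n.
Hypothesis v_bound : forall n, modulus (v n) <= Cv * 4^-1 ^+ n.

Let Cu0 : 0 <= Cu.
Proof. by have := le_trans (modulus_ge0 _) (u_bound 0%N); rewrite mulr1. Qed.

Let Cv0 : 0 <= Cv.
Proof. by have := le_trans (modulus_ge0 _) (v_bound 0%N); rewrite mulr1. Qed.

Let quarter_le_half (C : R) n : 0 <= C -> C * 4^-1 ^+ n <= C * 2^-1 ^+ n.
Proof.
move=> C0; rewrite ler_wpM2l// lerXn2r ?nnegrE ?invr_ge0// lef_pV2 ?posrE//.
by rewrite ler_nat.
Qed.

Let cvg_u : cvgn (series u).
Proof.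
apply: (@complex_geometric_cvg _ Cu) => n.
exact: le_trans (u_bound n) (quarter_le_half _ Cu0).
Qed.

Let cvg_v : cvgn (series v).
Proof.
apply: (@complex_geometric_cvg _ Cv) => n.
exact: le_trans (v_bound n) (quarter_le_half _ Cv0).
Qed.

Let a l m : R[i]^o := if (m < l)%N then 0 else u l * v (m - l)%N.

Let a_row l : limn (series (a l)) = u l * limn (series v).
Proof. by apply: complex_lim; exact: complex_series_shift. Qed.

Let a_bound l m : modulus (a l m) <= (Cu * Cv) * 4^-1 ^+ m.
Proof.
rewrite /a; case: ltnP => lm.
  by rewrite -[0]/(0%:C) modulus_real normr0 !mulr_ge0// exprn_ge0// invr_ge0.
rewrite modulusM -{2}(subnKC lm) exprD mulrACA.
by apply: ler_pM; rewrite ?modulus_ge0.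
Qed.

Let a_triangular l m : (m < l)%N -> a l m = 0.
Proof. by rewrite /a => ->. Qed.

Let a_col m : \sum_(l < m.+1) a l m = \sum_(l < m.+1) u l * v (m - l)%N.
Proof. by apply: eq_bigr => l _; rewrite /a ltnNge -ltnS ltn_ord. Qed.

Lemma complex_Cauchy_product_cvg :
  cvgn (series (fun m => \sum_(l < m.+1) u l * v (m - l)%N : R[i]^o)).
Proof.
apply: (@complex_geometric_cvg _ (Cu * Cv)) => m; rewrite -a_col.
exact: (triangular_col_bound a_bound).
Qed.

Lemma complex_Cauchy_product :
  limn (series (fun m => \sum_(l < m.+1) u l * v (m - l)%N : R[i]^o)) =
  limn (series u) * limn (series v).
Proof.
rewrite (_ : (fun m => _) = (fun m => \sum_(l < m.+1) a l m)); last first.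
  by apply/funext => m; rewrite a_col.
rewrite -(complex_lim (triangular_series a_bound a_triangular)); apply/complex_lim.
rewrite mulrC; apply: (complex_cvg_near (N := 0) (complex_cvgMc (x := limn (series v)) cvg_u)) => n _.
by rewrite /series /= mulr_sumr; apply: eq_bigr => l _; rewrite a_row mulrC.
Qed.

End CauchyProduct.

End ComplexSeries.

(** * Bessel functions *)

Section Bessel.
Variable R : realType.
Implicit Types (z x : R[i]) (w : R[i]^o) (nu : R).

Definition cis (t : R) : R[i] := cos t +i* sin t.

Lemma cisD t1 t2 : cis (t1 + t2) = cis t1 * cis t2.
Proof.
rewrite /cis cosD sinD; apply/eqP; rewrite eq_complex /=.
by rewrite eqxx addrC eqxx.
Qed.

Lemma cis0 : cis 0 = 1.
Proof. by rewrite /cis cos0 sin0. Qed.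

Lemma cisMn t n : cis (n%:R * t) = cis t ^+ n.
Proof.
elim: n => [|n IH]; first by rewrite mul0r cis0.
by rewrite -natr1 mulrDl mul1r cisD IH exprSr.
Qed.

Lemma cis_neq0 t : cis t != 0.
Proof.
apply/eqP => H; have := cisD t (- t); rewrite subrr cis0 H mul0r => /eqP.
by rewrite oner_eq0.
Qed.

Lemma cpowrE z nu : cpowr z nu = (modulus z `^ nu)%:C * cis (nu * carg z).
Proof. by []. Qed.

Lemma polar_form z : z != 0 -> z = (modulus z)%:C * cis (carg z).
Proof.
case: z => x y z0; set z := x +i* y; set m := modulus z.
have m0 : 0 < m by rewrite lt_neqAle modulus_ge0 andbT eq_sym modulus_eq0.
have m2 : m ^+ 2 = x ^+ 2 + y ^+ 2.
  by rewrite /m /modulus normc_def /= sqr_sqrtr// addr_ge0 ?sqr_ge0.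
have xm : -1 <= x / m <= 1.
  rewrite -ler_norml normrM normfV (ger0_norm (ltW m0)) ler_pdivrMr// mul1r.
  exact: (modulus_Re z).
have s2 : Num.sqrt (1 - (x / m) ^+ 2) = `|y| / m.
  have -> : 1 - (x / m) ^+ 2 = (y / m) ^+ 2.
    have mn0 : m != 0 by rewrite gt_eqF.
    have y2 : y ^+ 2 = m ^+ 2 - x ^+ 2 by rewrite m2 addrAC subrr add0r.
    rewrite !expr_div_n y2 mulrBl divff// expf_neq0//.
  by rewrite sqrtr_sqr normrM normfV (ger0_norm (ltW m0)).
have cs : cis (carg z) = (x / m) +i* (y / m).
  rewrite /carg -/(modulus z) -/m /=; case: ifPn => y0.
    by rewrite /cis acosK ?in_itv//= sin_acos// s2 ger0_norm.
  rewrite -ltNge in y0.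
  by rewrite /cis cosN sinN acosK ?in_itv//= sin_acos// s2 ltr0_norm// mulNr opprK.
rewrite cs (_ : m%:C * _ = (m * (x / m)) +i* (m * (y / m))); last by simpc.
by rewrite ![m * _]mulrC !divfK ?gt_eqF.
Qed.

Lemma cpowr_addn z nu n : z != 0 -> cpowr z (n%:R + nu) = z ^+ n * cpowr z nu.
Proof.
move=> z0; have m0 : modulus z != 0 by rewrite modulus_eq0.
rewrite !cpowrE [in RHS](polar_form z0) exprMn -cisMn -rmorphXn /=.
rewrite [modulus (_ * cis _)](_ : _ = modulus z) -?polar_form//.
rewrite powRD ?m0 ?implybT// powR_mulrn ?modulus_ge0// mulrDl cisD rmorphM /=.
by rewrite mulrACA.
Qed.

Lemma modulus_half z : modulus (z / 2) = modulus z / 2.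
Proof.
rewrite modulusM modulusV (_ : 2 = (2%:R : R)%:C); last by rewrite rmorph_nat.
by rewrite modulus_real ger0_norm.
Qed.

Lemma carg_half z : carg (z / 2) = carg z.
Proof.
rewrite /carg -!/(modulus _) modulus_half.
have -> : z / 2 = (complex.Re z / 2) +i* (complex.Im z / 2).
  case: z => x y; rewrite (_ : 2^-1 = (2^-1 : R)%:C); first by simpc.
  by rewrite fmorphV rmorph_nat.
by rewrite /= -mulf_div divff ?pnatr_eq0// mulr1 pmulr_lge0 ?invr_gt0.
Qed.

(** Halving does not change the argument, so both powers are on the same branch and their quotient
    is a positive constant. *)
Lemma cpowr_half z nu : cpowr (z / 2) nu = (2 `^ (- nu))%:C * cpowr z nu.
Proof.
rewrite !cpowrE carg_half modulus_half powRM ?modulus_ge0// mulrA; congr (_ * _).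
by rewrite -rmorphM mulrC powRN -powR_inv1// -powRrM mulN1r powRN.
Qed.

Lemma cpowr_neq0 z nu : z != 0 -> cpowr z nu != 0.
Proof.
move=> z0; rewrite cpowrE mulf_neq0 ?cis_neq0//.
rewrite (inj_eq (@complexI R) _ 0) gt_eqF// powR_gt0// lt_neqAle modulus_ge0 andbT.
by rewrite eq_sym modulus_eq0.
Qed.

Section Coefficients.
Variable D : nat.
Local Notation h := (D.+2%:R / 2 : R).
Local Notation nu := (D%:R / 2 : R).

Lemma poch_ge1 n : 1 <= poch h n.
Proof.
elim: n => [|n IH]; first by rewrite poch0.
rewrite pochS mulr_ege1// -natr1 -natr1; have := ler0n R D; have := ler0n R n; lra.
Qed.

(** The m-th coefficient of the Bessel series of order l + nu, where Gamma (m + l + nu + 1) is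
    replaced by its quotient by Gamma h. *)
Definition bessel_coef (l m : nat) : R := (-1) ^+ m / (m`!%:R * poch h (l + m)).

Definition bessel_term l x m : R[i]^o := (bessel_coef l m)%:C * x ^+ m.

Definition bessel_series l x : R[i]^o := limn (series (bessel_term l x)).

Lemma expR_term (t : R) n : 0 <= t -> t ^+ n / n`!%:R <= expR t.
Proof.
case: n => [|n] t0; last by apply: le_trans (expR_ge1Dxn n t0); rewrite lerDr.
by rewrite expr0 mul1r fact0 invr1 -expR0 ler_expR.
Qed.

Lemma bessel_coef_le l m : `|bessel_coef l m| <= m`!%:R^-1.
Proof.
have f0 : 0 < m`!%:R :> R by rewrite ltr0n fact_gt0.
have p0 : 0 < poch h (l + m) := lt_le_trans ltr01 (poch_ge1 _).
rewrite /bessel_coef normrM normrX normrN1 expr1n mul1r ger0_norm; last by rewrite invr_ge0 mulr_ge0 ?ltW.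
by rewrite lef_pV2 ?posrE ?mulr_gt0// ler_peMr ?poch_ge1// ltW.
Qed.

Lemma bessel_term_le l x m : modulus (bessel_term l x m) <= modulus x ^+ m / m`!%:R.
Proof.
rewrite modulusM modulus_real modulusX mulrC ler_wpM2l ?bessel_coef_le//.
by rewrite exprn_ge0// modulus_ge0.
Qed.

(** Since (4 |x|)^m / m! is a term of the exponential series. The ratio 1/4 is the one that Cauchy
    products require. *)
Lemma bessel_term_geometric l x m :
  modulus (bessel_term l x m) <= expR (4 * modulus x) * 4^-1 ^+ m.
Proof.
apply: le_trans (bessel_term_le _ _ _) _.
have -> : modulus x ^+ m / m`!%:R = (4 * modulus x) ^+ m / m`!%:R * 4^-1 ^+ m.
  by rewrite mulrAC -exprMn mulrAC mulfV ?mul1r// pnatr_eq0.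
by rewrite ler_wpM2r ?expR_term// ?mulr_ge0 ?modulus_ge0// exprn_ge0// invr_ge0.
Qed.

Lemma quarter_le_half n : (4^-1 : R) ^+ n <= 2^-1 ^+ n.
Proof. by rewrite lerXn2r ?nnegrE ?invr_ge0// lef_pV2 ?posrE// ler_nat. Qed.

Lemma bessel_series_cvg l x : cvgn (series (bessel_term l x)).
Proof.
apply: (@complex_geometric_cvg _ _ (expR (4 * modulus x))) => m.
apply: le_trans (bessel_term_geometric l x m) _.
by rewrite ler_wpM2l ?expR_ge0 ?quarter_le_half.
Qed.

(** The constant terms cancel, so every remaining term has a factor |x|; 2^m / m! <= e^2 bounds what
    is left geometrically. *)
Lemma bessel_series_near0 l x : modulus x <= 1 ->
  modulus (bessel_series l x - bessel_series l 0) <= 2 * (modulus x * expR 2).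
Proof.
move=> x1; pose b m : R[i]^o := bessel_term l x m - bessel_term l 0 m.
have -> : bessel_series l x - bessel_series l 0 = limn (series b).
  apply/esym/complex_lim.
  rewrite (_ : series b = series (bessel_term l x) - series (bessel_term l 0)).
    exact: (cvgB (@bessel_series_cvg l x) (@bessel_series_cvg l 0)).
  by apply/funext => n; rewrite /series /= !fctE sumrB.
rewrite -[leRHS]mulr1 -(expr0 (2^-1 : R)).
apply: complex_geometric_lim => // m; rewrite /b.
case: m => [|m].
  by rewrite /bessel_term !expr0 subrr -[0]/(0%:C) modulus_real normr0 mulr1 mulr_ge0 ?modulus_ge0 ?expR_ge0.
rewrite {2}/bessel_term expr0n mulr0 subr0.
apply: le_trans (bessel_term_le _ _ _) _.
have -> : modulus x ^+ m.+1 / m.+1`!%:R = modulus x * modulus x ^+ m * (2 ^+ m.+1 / m.+1`!%:R) * 2^-1 ^+ m.+1.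
  rewrite exprS exprVn; have : 2 ^+ m.+1 != 0 :> R by rewrite expf_neq0.
  by move: (2 ^+ m.+1) => y y0; field; rewrite y0 pnatr_eq0 -lt0n fact_gt0.
rewrite ler_wpM2r ?exprn_ge0 ?invr_ge0//; apply: ler_pM; rewrite ?expR_term// ?mulr_ge0 ?exprn_ge0 ?modulus_ge0 ?invr_ge0//.
by rewrite ler_piMr ?modulus_ge0// exprn_ile1// modulus_ge0.
Qed.

(** The power of 2 comes from (w/2)^(l + nu) / w^nu, the Gamma factor from the normalization of
    [bessel_coef]. It is the same for all l. *)
Definition bessel_const : R := 2 `^ (- nu) / Gamma h.

Lemma BesselJE l w : BesselJ (l%:R + nu) w =
  cpowr (w / 2) (l%:R + nu) * (Gamma h)^-1%:C * bessel_series l ((w / 2) ^+ 2).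
Proof.
rewrite /BesselJ -mulrA; congr (_ * _).
have h0 : 0 < h by rewrite divr_gt0.
apply: complex_lim.
have cb := complex_cvgMc (x := (Gamma h)^-1%:C) (@bessel_series_cvg l ((w / 2) ^+ 2)).
apply: (complex_cvg_near (N := 0) cb) => n _.
rewrite /series /= mulr_sumr; apply: eq_bigr => m _.
have -> : m%:R + (l%:R + nu) + 1 = h + (l + m)%:R by rewrite natrD -natr1 -natr1; field.
rewrite Gamma_poch// /bessel_term -exprM -mul2n [RHS]mulrA -rmorphM /=; congr (_%:C * _).
have G0 : Gamma h != 0 by rewrite gt_eqF// Gamma_gt0.
have p0 : poch h (l + m) != 0 by rewrite gt_eqF// poch_gt0.
have f0 : m`!%:R != 0 :> R by rewrite pnatr_eq0 -lt0n fact_gt0.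
rewrite /bessel_coef; move: (Gamma h) (poch h (l + m)) (m`!%:R) G0 p0 f0 => G p f' *.
by field; do ?[apply/andP; split=> //].
Qed.

Definition bessel_entire l w : R[i]^o :=
  bessel_const%:C * ((w / 2) ^+ l * bessel_series l ((w / 2) ^+ 2)).

Lemma bessel_quotient l w : w != 0 ->
  BesselJ (l%:R + nu) w / cpowr w nu = bessel_entire l w.
Proof.
move=> w0; have c0 := cpowr_neq0 nu w0.
have w20 : w / 2 != 0 by rewrite mulf_neq0// invr_eq0 pnatr_eq0.
rewrite BesselJE (cpowr_addn _ _ w20) cpowr_half /bessel_entire /bessel_const rmorphM /=.
move: (bessel_series _ _) ((w / 2) ^+ l) (cpowr w nu) c0 => b y c c0.
by move: ((2 `^ (- nu))%:C) ((Gamma h)^-1%:C) => P G; field.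
Qed.

Lemma bessel_series_half_cvg0 l :
  bessel_series l ((w / 2) ^+ 2) @[w --> (0 : R[i]^o)] --> bessel_series l 0.
Proof.
apply/(@cvgrPdist_lt _ _ _ _ (nbhs_filter (0 : R[i]^o))) => e /complex_gt0[-> e0].
(* [bessel_series_near0] needs a modulus at most 1 and has the constant 2 e^2; moreover |w / 2|^2 <=
   |w| for |w| <= 1. *)
pose r := Num.min 1 (complex.Re e / (2 * expR 2)).
have E2 : 0 < 2 * expR 2 :> R by rewrite mulr_gt0// expR_gt0.
have r0 : 0 < r by rewrite lt_min ltr01 divr_gt0.
apply/nbhs_ballP; exists r%:C => /=; first by rewrite ltcR.
move=> w; rewrite /ball /= sub0r normrN modulusE ltcR lt_min => /andP[w1 we].
rewrite distrC modulusE ltcR.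
have x1 : modulus ((w / 2) ^+ 2) <= modulus w.
  rewrite modulusX modulus_half expr2 mulrACA -expr2 expr2 -mulrA ler_piMr ?modulus_ge0//.
  have := ltW w1; have := modulus_ge0 w; lra.
apply: le_lt_trans (bessel_series_near0 _ (le_trans x1 (ltW w1))) _.
rewrite mulrCA; apply: le_lt_trans (_ : modulus w * (2 * expR 2) < _).
  by rewrite ler_wpM2r// ltW.
by rewrite -ltr_pdivlMr.
Qed.

Lemma bessel_entire_cvg0 l :
  bessel_entire l w @[w --> (0 : R[i]^o)^'] --> (bessel_entire l 0 : R[i]^o).
Proof.
pose F := nbhs_filter (0 : R[i]^o).
have c1 : (w / 2 : R[i]^o) @[w --> (0 : R[i]^o)] --> (0 / 2 : R[i]^o).
  exact: (@cvgM _ _ _ F _ _ _ _ (@cvg_id _ _) (@cvg_cst _ _ _ _ F)).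
have c2 : ((w / 2) ^+ l : R[i]^o) @[w --> (0 : R[i]^o)] --> ((0 / 2) ^+ l : R[i]^o).
  elim: l => [|l IH].
    rewrite expr0 (_ : (fun w => _) = cst 1); first exact: (@cvg_cst _ _ _ _ F).
    by apply/funext => w; rewrite expr0.
  rewrite exprS (_ : (fun w => _) = (fun w => (w / 2) * (w / 2) ^+ l)).
    exact: (@cvgM _ _ _ F _ _ _ _ c1 IH).
  by apply/funext => w; rewrite exprS.
have c3 := @bessel_series_half_cvg0 l.
have c4 := @cvgM _ _ _ F _ _ _ _ (@cvg_cst _ (bessel_const%:C : R[i]^o) _ _ F)
  (@cvgM _ _ _ F _ _ _ _ c2 c3).
rewrite /bessel_entire [(0 / 2) ^+ 2](_ : _ = 0); last by rewrite mul0r expr0n.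
exact: (@cvg_within_filter _ _ _ _ F _ _ c4).
Qed.

Lemma besselphiE l z : besselphi D.+2 l z = bessel_entire l z.
Proof.
have nuE : nu_ R D.+2 = nu by rewrite /nu_ -natr1 -natr1; congr (_ / _); ring.
rewrite /besselphi nuE; case: eqVneq => [->|z0]; last exact: bessel_quotient.
have c : (BesselJ (l%:R + nu) w / cpowr w nu : R[i]^o) @[w --> (0 : R[i]^o)^'] -->
    (bessel_entire l 0 : R[i]^o).
  refine (cvg_trans _ (@bessel_entire_cvg0 l)); apply: near_eq_cvg.
  by apply: filterS (nbhs_dnbhs_neq (0 : R[i]^o)) => w w0; rewrite bessel_quotient.
exact: (@cvg_lim _ (@norm_hausdorff _ _) _ _ _ _ _ c).
Qed.

(** The subtraction [m - l] in [square_coef] is truncated, hence the explicit zero below the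
    diagonal. *)
Definition bessel_sqr_coef l m : R := if (m < l)%N then 0 else square_coef R D m l.

(** The variable is x = z^2 / 4 here, whereas [square_coef] refers to powers of z^2; this accounts
    for the power of 4. *)
Definition bessel_square_term l x j : R[i]^o :=
  (square_coef R D (l + j) l * 4 ^+ (l + j))%:C * x ^+ j.

Lemma bessel_square_termE l x j :
  \sum_(i < j.+1) bessel_term l x i * bessel_term l x (j - i) = bessel_square_term l x j.
Proof.
transitivity ((\sum_(i < j.+1) bessel_coef l i * bessel_coef l (j - i))%:C * x ^+ j).
  rewrite rmorph_sum /= mulr_suml; apply: eq_bigr => i _.
  by rewrite /bessel_term mulrACA -exprD subnKC ?leq_ord// -rmorphM.
congr (_%:C * _).
rewrite (eq_bigr (fun i : 'I_j.+1 => (-1) ^+ j * ((i`!%:R * poch h (l + i))^-1 * ((j - i)`!%:R * poch h (l + (j - i)))^-1))).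
  rewrite -mulr_sumr bessel_square_coef /square_coef addKn.
  have : 4 ^+ (l + j) != 0 :> R by rewrite expf_neq0.
  by move: (4 ^+ (l + j)) => y y0; rewrite [RHS]mulrC !mulrA mulfV// mul1r.
by move=> i _; rewrite /bessel_coef mulrACA -exprD subnKC ?leq_ord//.
Qed.

Lemma bessel_square_cvg l x : cvgn (series (bessel_square_term l x)).
Proof.
rewrite (_ : bessel_square_term l x = fun j => \sum_(i < j.+1) bessel_term l x i * bessel_term l x (j - i)).
  exact: (complex_Cauchy_product_cvg (bessel_term_geometric l x) (bessel_term_geometric l x)).
by apply/funext => j; rewrite bessel_square_termE.
Qed.

Lemma bessel_series_sqr l x :
  bessel_series l x ^+ 2 = limn (series (bessel_square_term l x)).
Proof.
rewrite expr2 -(complex_Cauchy_product (bessel_term_geometric l x) (bessel_term_geometric l x)).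
by congr (limn (series _)); apply/funext => j; exact: bessel_square_termE.
Qed.

Lemma besselphi_sqr l z :
  series (fun m => (bessel_const ^+ 2 * bessel_sqr_coef l m)%:C * (z ^+ 2) ^+ m : R[i]^o) @ \oo -->
  (besselphi D.+2 l z ^+ 2 : R[i]^o).
Proof.
set x := z ^+ 2 / 4.
have -> : besselphi D.+2 l z ^+ 2 =
    (bessel_const ^+ 2)%:C * (x ^+ l * limn (series (bessel_square_term l x))).
  rewrite besselphiE /bessel_entire exprMn -rmorphXn /=; congr (_ * _).
  rewrite exprMn bessel_series_sqr -exprM mulnC exprM.
  have -> : (z / 2) ^+ 2 = z ^+ 2 / 4 by rewrite expr_div_n; congr (_ / _); rewrite -natrX.
  by [].
have sh := @complex_series_shift _ _ (x ^+ l) l (@bessel_square_cvg l x).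
have shc := complex_cvgMc (x := (bessel_const ^+ 2)%:C) sh.
refine (complex_cvg_near (N := 0) shc _) => n _; rewrite /series /= mulr_sumr.
apply: eq_bigr => m _; rewrite rmorphM /= -mulrA; congr (_ * _).
rewrite /bessel_sqr_coef; case: ltnP => lm; first by rewrite mul0r.
rewrite /bessel_square_term subnKC//; move: (square_coef R D m l) => s.
rewrite rmorphM rmorphXn /= mulrCA -exprD subnKC// -mulrA.
by congr (_ * _); rewrite rmorph_nat -exprMn /x mulrCA mulfV ?mulr1// pnatr_eq0.
Qed.

End Coefficients.
End Bessel.

(** * Bounds *)

Section EntireBounds.
Variable R : realType.

Lemma leq_bin_exp2 n k : ('C(n, k) <= 2 ^ n)%N.
Proof.
elim: n k => [|n IH] [|k]; rewrite ?bin0 ?expn_gt0// binS expnS mul2n -addnn.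
exact: leq_add.
Qed.

Lemma bin_le_exp2 n k : 'C(n, k)%:R <= 2 ^+ n :> R.
Proof. by rewrite -natrX ler_nat leq_bin_exp2. Qed.

(** For any ratio r, (Q / r)^m / m! is at most exp (Q / r). *)
Lemma entire_fact (c : nat -> R) (E Q : R) : 0 <= E -> 0 <= Q ->
  (forall m, `|c m| <= E * (Q ^+ m / m`!%:R)) -> entire c.
Proof.
move=> E0 Q0 H r r0; exists (E * expR (Q / r)) => m; apply: le_trans (H m) _.
rewrite -mulrA ler_wpM2l//.
have -> : Q ^+ m / m`!%:R = (Q / r) ^+ m / m`!%:R * r ^+ m.
  by rewrite mulrAC -exprMn divfK// gt_eqF.
by rewrite ler_wpM2r ?exprn_ge0 ?(ltW r0)// expR_term// divr_ge0// ltW.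
Qed.

End EntireBounds.

Section PairingComplexSeries.
Variables (R : realType) (d : nat) (f : compact_distribution R d).
Local Notation V := 'rV[R]_d.

Lemma pairing_complex_pseries (q : V -> R) (c : nat -> R[i]) : real_smooth q ->
  entire (fun m => complex.Re (c m)) -> entire (fun m => complex.Im (c m)) ->
  series (fun m => c m * f (fun x => (q x ^+ m)%:C) : R[i]^o) @ \oo -->
  (f (fun x => limn (series (fun m => c m * (q x)%:C ^+ m : R[i]^o))) : R[i]^o).
Proof.
move=> sq eR eI.
have E x : limn (series (fun m => c m * (q x)%:C ^+ m : R[i]^o)) =
  limn (pseries (fun m => complex.Re (c m)) (q x)) +i*
  limn (pseries (fun m => complex.Im (c m)) (q x)).
  apply: complex_lim; apply: cvgn_series_ReIm.
  - rewrite (_ : (fun n => complex.Re _) = (fun m => complex.Re (c m) * q x ^+ m)).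
      exact: (entire_cvg eR).
    by apply/funext => m; rewrite -rmorphXn /=; case: (c m) => a b; simpc.
  - rewrite (_ : (fun n => complex.Im _) = (fun m => complex.Im (c m) * q x ^+ m)).
      exact: (entire_cvg eI).
    by apply/funext => m; rewrite -rmorphXn /=; case: (c m) => a b; simpc.
have -> : f (fun x => limn (series (fun m => c m * (q x)%:C ^+ m : R[i]^o))) =
    f (fun x => limn (pseries (fun m => complex.Re (c m)) (q x)) +i*
                limn (pseries (fun m => complex.Im (c m)) (q x))).
  by congr (pairing f _); apply/funext => x; exact: E.
have sR := real_smooth_pseries sq eR; have sI := real_smooth_pseries sq eI.
rewrite (pairing_complex f sR sI).
have cR := @pairing_pseries R d f q _ sq eR.
have cI := complex_cvgMc (x := 'i) (@pairing_pseries R d f q _ sq eI).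
have cRI := complex_cvgD cR cI.
refine (complex_cvg_near (N := 0) cRI _) => n _.
rewrite /series /= mulr_sumr -big_split /=; apply: eq_bigr => m _.
by rewrite mulrA -mulrDl; congr (_ * _); case: (c m) => a b; simpc.
Qed.

(** The terms of a convergent series are bounded. With [c] free among entire sequences, this
    controls the growth of the moments of [f]. *)
Lemma pairing_entire_bounded (q : V -> R) (c : nat -> R) : real_smooth q -> entire c ->
  exists2 C : R, 0 <= C & forall m, `|c m| * modulus (f (fun x => (q x ^+ m)%:C)) <= C.
Proof.
move=> sq ec; have /cvgn_modulusP cv := @pairing_pseries R d f q c sq ec.
set L := f _ in cv; pose t m : R := `|c m| * modulus (f (fun x => (q x ^+ m)%:C)).
have t0 m : 0 <= t m by rewrite mulr_ge0// modulus_ge0.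
(* Beyond [N] consecutive partial sums are within 1 of the limit, so a term has modulus at most 2;
   the earlier terms are bounded by their sum. *)
have [N HN] := cv 1 ltr01.
exists (2 + \sum_(k < N) t k); first by rewrite addr_ge0// sumr_ge0.
move=> m; rewrite -/(t m); have [mN|Nm] := ltnP m N.
  rewrite (bigD1 (Ordinal mN)) //= addrCA lerDl addr_ge0// sumr_ge0//.
apply: (@le_trans _ _ 2); last by rewrite lerDl sumr_ge0.
have h1 := HN _ Nm; have h2 := HN _ (leqW Nm).
have -> : t m = modulus ((c m)%:C * f (fun x => (q x ^+ m)%:C)) by rewrite modulusM modulus_real.
move: h2; rewrite {1}/series /= big_nat_recr//= -/(series _ _).
set S := series _ _ in h1 *; set T := _ * _ => h2.
have -> : T = (S + T - L) + (L - S) by rewrite addrA subrK addrC addKr.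
apply: le_trans (modulusD _ _) _; rewrite [leRHS](_ : 2 = 1 + 1)//.
by apply: lerD; apply: ltW => //; rewrite modulusB.
Qed.

End PairingComplexSeries.

(** * Normalization and growth of the zonal polynomials and of the Bessel coefficients *)

Section Addition.
Variables (R : realType) (D : nat).
Local Notation d := D.+2.
Local Notation h := (D.+2%:R / 2 : R).
Local Notation area := (sphere_area R d).
Local Notation N := (harmonic_dim R d).

Lemma harmonic_dim_bin l :
  (N l + 'C(l.-2 + D.+1, D.+1) * (1 < l) = 'C(l + D.+1, D.+1))%N.
Proof. by apply: HarmonicDim.dim_harmonic; exact: Num.Theory.pchar_num. Qed.

Lemma harmonic_dim_le l : (N l)%:R <= 2 ^+ D.+1 * 2 ^+ l :> R.
Proof.
rewrite -exprD addnC (le_trans _ (bin_le_exp2 R (l + D.+1) D.+1))// ler_nat.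
by rewrite -harmonic_dim_bin leq_addr.
Qed.

Lemma sphere_area_gt0 : 0 < area.
Proof.
by rewrite /sphere_area divr_gt0 ?Gamma_gt0 ?divr_gt0// mulr_gt0// powR_gt0 ?pi_gt0.
Qed.

(** One area comes from sigma_l and one from Z_l; the Gamma factors cancel against those of the
    Bessel functions. This is where the factor (2 pi)^d of the theorem originates. *)
Lemma sphere_area_const :
  (2 * pi) ^+ d * (bessel_const R D ^+ 2 / area ^+ 2) = 1.
Proof.
have p0 := @pi_gt0 R; have G0 : Gamma h != 0 by rewrite gt_eqF// Gamma_gt0 ?divr_gt0.
rewrite /bessel_const /sphere_area.
have e1 : (2 `^ (- (D%:R / 2))) ^+ 2 = 2 ^- D :> R.
  by rewrite -powR_mulrn ?powR_ge0// -powRrM mulNr divfK// powRN powR_mulrn.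
have e2 : (pi `^ h) ^+ 2 = pi ^+ d :> R.
  by rewrite -powR_mulrn ?powR_ge0// -powRrM divfK// powR_mulrn// ltW.
rewrite !expr_div_n !exprMn e1 e2.
have P0 : pi ^+ d != 0 :> R by rewrite expf_neq0// gt_eqF.
have T0 : 2 ^+ D != 0 :> R by rewrite expf_neq0.
rewrite [2 ^+ d](_ : _ = 2 ^+ D * 2 ^+ 2); last by rewrite -exprD addn2.
move: (pi ^+ d) (2 ^+ D) (Gamma h) P0 T0 G0 => P T G *.
by field; do ?[apply/andP; split=> //].
Qed.

Lemma poch_half_ge n : n`!%:R / 2 ^+ n <= poch (D.+1%:R / 2 : R) n.
Proof.
elim: n => [|n IH]; first by rewrite poch0 expr0 divr1.
rewrite pochS factS natrM exprS invfM mulrACA mulrC; apply: ler_pM => //.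
by rewrite -[n.+1%:R]natr1 -[D.+1%:R]natr1; have := ler0n R D; have := ler0n R n; lra.
Qed.

Lemma poch_nat_le l i : poch (l%:R : R) i <= i`!%:R * 2 ^+ (l + i).
Proof.
(* Raising the base by one makes the symbol a quotient of factorials, i! times a binomial
   coefficient, even for [l = 0]. *)
apply: (@le_trans _ _ (poch l.+1%:R i)).
  apply: ler_prod => k _; rewrite addr_ge0//= lerD2r ler_nat//.
rewrite poch_nat ler_pdivrMr ?ltr0n ?fact_gt0//.
have := bin_fact (leq_addl l i); rewrite addnK => <-; rewrite !natrM.
have := bin_le_exp2 R (l + i) i.
have := ler0n R (i`!); have := ler0n R (l`!).
move: ('C(l + i, i)%:R : R) (i`!%:R : R) (l`!%:R : R) (2 ^+ (l + i) : R) => b x y z y0 x0 bz.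
apply: le_trans (ler_wpM2r (mulr_ge0 x0 y0) bz) _.
by rewrite mulrA [z * x]mulrC.
Qed.

(** The binomial coefficient is kept so that summation against |w|^i gives (1 + 2 |w|)^l. *)
Lemma legendre_coef_le l i : `|legendre_coef R D l i| <= 2 ^+ (l + D) * (2 ^+ i *+ 'C(l, i)).
Proof.
have e0 : 0 < D.+1%:R / 2 :> R by rewrite divr_gt0.
have f0 : 0 < i`!%:R / 2 ^+ i :> R by rewrite divr_gt0 ?exprn_gt0// ltr0n fact_gt0.
have pe : 0 < poch (D.+1%:R / 2 : R) i by exact: poch_gt0.
have pl0 : 0 <= poch ((l + D)%:R : R) i by apply: prodr_ge0 => k _; rewrite addr_ge0.
rewrite /legendre_coef !normrM normrX normrN1 expr1n mul1r !normfV normrX !ger0_norm ?ler0n ?(ltW pe)//.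
rewrite ler_pdivrMr//.
apply: (@le_trans _ _ (2 ^- i * 'C(l, i)%:R * (i`!%:R * 2 ^+ (l + D + i)))).
  by rewrite ler_wpM2l ?mulr_ge0 ?invr_ge0 ?exprn_ge0// poch_nat_le.
apply: (@le_trans _ _ (2 ^+ (l + D) * (2 ^+ i *+ 'C(l, i)) * (i`!%:R / 2 ^+ i))).
  rewrite [2 ^+ (l + D + i)]exprD -[_ *+ 'C(l, i)]mulr_natr le_eqVlt; apply/orP; left; apply/eqP.
  by move: (2 ^+ (l + D) : R) ((2 ^+ i)^-1 : R) (2 ^+ i : R) => x y z; ring.
by rewrite ler_wpM2l ?mulr_ge0 ?exprn_ge0 ?mulrn_wge0 ?exprn_ge0// poch_half_ge.
Qed.

Definition zonal_coef l i : R := (N l)%:R / area * legendre_coef R D l i.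

Lemma zonalE l (w : R[i]) :
  zonal d l (1 - w) = \sum_(i < l.+1) (zonal_coef l i)%:C * w ^+ i.
Proof.
rewrite /zonal linearZ_LR /= hornerZ legendreE rmorph_sum /= horner_sum mulr_sumr.
apply: eq_bigr => i _; rewrite linearZ_LR /= hornerZ mulrA -rmorphM; congr (_ * _).
by rewrite rmorphXn /= rmorphB rmorph1 /= map_polyX horner_exp !hornerE opprB addrC subrK.
Qed.

Lemma zonal_le (w : R[i]) : exists C Q : R, [/\ 0 <= C, 0 <= Q &
  forall l, modulus (zonal d l (1 - w)) <= C * Q ^+ l].
Proof.
(* The 4 is a factor 2 from the dimension N_l and another from the Legendre coefficients. *)
pose Q : R := 4 * (1 + 2 * modulus w).
have Q0 : 0 <= 1 + 2 * modulus w by rewrite addr_ge0// mulr_ge0// modulus_ge0.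
have A0 := sphere_area_gt0.
exists (2 ^+ D.+1 / area * 2 ^+ D), Q; split.
- by rewrite !mulr_ge0 ?invr_ge0 ?exprn_ge0 ?(ltW A0).
- by rewrite mulr_ge0.
move=> l; rewrite zonalE.
rewrite -(big_mkord xpredT (fun i => (zonal_coef l i)%:C * w ^+ i)).
apply: le_trans (modulus_sum _ _) _; rewrite big_mkord.
apply: (@le_trans _ _ (\sum_(i < l.+1) (2 ^+ D.+1 * 2 ^+ l / area * 2 ^+ (l + D)) *
    ((2 * modulus w) ^+ i *+ 'C(l, i)))).
  apply: ler_sum => i _; rewrite modulusM modulus_real modulusX /zonal_coef normrM.
  have H1 : `|(N l)%:R / area| <= 2 ^+ D.+1 * 2 ^+ l / area.
    rewrite normrM normfV normr_nat (ger0_norm (ltW A0)).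
    by apply: ler_wpM2r; [rewrite invr_ge0 ltW|exact: harmonic_dim_le].
  have H2 := ler_pM (normr_ge0 _) (normr_ge0 _) H1 (legendre_coef_le l i).
  apply: le_trans (ler_wpM2r (exprn_ge0 i (modulus_ge0 w)) H2) _.
  have E (x y z t : R) c : x * (y * (z *+ c)) * t = x * y * ((z * t) *+ c).
    by rewrite -[z *+ c]mulr_natr -[(z * t) *+ c]mulr_natr; ring.
  by rewrite E [(2 * modulus w) ^+ i]exprMn.
rewrite -mulr_sumr.
have -> : \sum_(i < l.+1) (2 * modulus w) ^+ i *+ 'C(l, i) = (1 + 2 * modulus w) ^+ l.
  by rewrite exprDn; apply: eq_bigr => i _; rewrite expr1n mul1r.
rewrite /Q exprMn exprD (_ : 4 ^+ l = 2 ^+ l * 2 ^+ l); last by rewrite -exprMn -natrM.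
by rewrite le_eqVlt; apply/orP; left; apply/eqP; ring.
Qed.

(** The binomial coefficient is at most 4^m 2^D, which cancels 4^-m. Of the two factors (h)_m in the
    denominator, one is at least m! and the other at least 1. *)
Lemma bessel_sqr_coef_le l m : `|bessel_sqr_coef R D l m| <= 2 ^+ D / m`!%:R.
Proof.
rewrite /bessel_sqr_coef; case: ifP => _; first by rewrite normr0 divr_ge0 ?exprn_ge0.
have f0 : 0 < m`!%:R :> R by rewrite ltr0n fact_gt0.
have p0 : 0 < poch h m by rewrite poch_gt0// divr_gt0.
have pf : m`!%:R <= poch h m.
  elim: m {f0 p0} => [|m IH]; first by rewrite poch0.
  rewrite pochS factS natrM mulrC ler_pM// -[D.+2%:R]natr1 -[D.+1%:R]natr1 -[m.+1%:R]natr1.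
  by have := ler0n R D; have := ler0n R m; lra.
rewrite /square_coef !normrM normrX normrN1 expr1n mulr1 !normfV !normrX !ger0_norm ?ler0n ?(ltW p0)//.
apply: ler_pM; rewrite ?mulr_ge0 ?invr_ge0 ?exprn_ge0 ?(ltW p0)//.
  rewrite ler_pdivrMl ?exprn_gt0// (le_trans (bin_le_exp2 _ _ _))// exprD -mul2n exprM.
  by rewrite (_ : 2 ^+ 2 = 4)// -natrX.
rewrite lef_pV2 ?posrE ?exprn_gt0// expr2 (le_trans pf)// ler_peMl ?poch_ge1// ltW//.
Qed.

End Addition.

(** * The expansion *)

Section Expansion.
Variables (R : realType) (D : nat) (f : compact_distribution R D.+2) (kappa : R[i]).
Local Notation d := D.+2.
Local Notation h := (D.+2%:R / 2 : R).
Local Notation area := (sphere_area R d).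
Local Notation N := (harmonic_dim R d).
Local Notation K := (bessel_const R D ^+ 2).

Definition moment m : R[i] := f (fun x => (dot x x ^+ m)%:C).

Definition sigma_coef l m : R[i] := (K * bessel_sqr_coef R D l m)%:C * kappa ^+ m.

Lemma bessel_const2_ge0 : 0 <= K. Proof. exact: sqr_ge0. Qed.

Lemma sigma_coef_le l m :
  modulus (sigma_coef l m) <= (K * 2 ^+ D) * (modulus kappa ^+ m / m`!%:R).
Proof.
rewrite modulusM modulus_real modulusX normrM (ger0_norm bessel_const2_ge0).
rewrite [leRHS](_ : _ = K * (2 ^+ D / m`!%:R) * modulus kappa ^+ m); last by ring.
rewrite ler_wpM2r ?exprn_ge0 ?modulus_ge0// ler_wpM2l ?bessel_const2_ge0//.
exact: bessel_sqr_coef_le.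
Qed.

Lemma sigma_series l :
  series (fun m => (area^-1)%:C * (sigma_coef l m * moment m) : R[i]^o) @ \oo -->
  (sigma f kappa l : R[i]^o).
Proof.
have E0 : 0 <= K * 2 ^+ D by rewrite mulr_ge0 ?bessel_const2_ge0 ?exprn_ge0.
have eR : entire (fun m => complex.Re (sigma_coef l m)).
  apply: (entire_fact E0 (modulus_ge0 kappa)) => m.
  exact: le_trans (modulus_Re _) (sigma_coef_le l m).
have eI : entire (fun m => complex.Im (sigma_coef l m)).
  apply: (entire_fact E0 (modulus_ge0 kappa)) => m.
  exact: le_trans (modulus_Im _) (sigma_coef_le l m).
have c1 := @pairing_complex_pseries R d f _ _ (@real_smooth_dotxx R d) eR eI.
have c2 := complex_cvgMc (x := (area^-1)%:C) c1.
rewrite /sigma (_ : f _ = f (fun x => limn (series (fun m => sigma_coef l m * (dot x x)%:C ^+ m : R[i]^o)))).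
  refine (complex_cvg_near (N := 0) c2 _) => n _.
  by rewrite /series /= mulr_sumr.
congr (pairing f _); apply/funext => x; apply/esym/complex_lim.
have := @besselphi_sqr R D l (sqrtC kappa * (enorm x)%:C).
(* The choice of the square root of kappa, and the nonsmooth norm of x, disappear here. *)
have zE : (sqrtC kappa * (enorm x)%:C) ^+ 2 = kappa * (dot x x)%:C.
  by rewrite exprMn sqrtCK -rmorphXn /= enorm_sqr.
rewrite zE => c3.
refine (complex_cvg_near (N := 0) c3 _) => n _.
by rewrite /series /=; apply: eq_bigr => m _; rewrite [(kappa * _) ^+ m]exprMn mulrA.
Qed.

Section Point.
Variable xi : 'rV[R]_d.
Local Notation w := ((enorm xi ^+ 2)%:C / (2 * kappa)).

Definition expansion_term l m : R[i]^o :=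
  zonal d l (1 - w) * ((area^-1)%:C * (sigma_coef l m * moment m)).

Lemma expansion_row l :
  limn (series (expansion_term l)) = sigma f kappa l * zonal d l (1 - w).
Proof.
apply: complex_lim; rewrite mulrC.
have c := complex_cvgMc (x := zonal d l (1 - w)) (@sigma_series l).
by refine (complex_cvg_near (N := 0) c _) => n _; rewrite /series /= mulr_sumr.
Qed.

Lemma expansion_term_triangular l m : (m < l)%N -> expansion_term l m = 0.
Proof.
by move=> ml; rewrite /expansion_term /sigma_coef /bessel_sqr_coef ml !(mulr0, mul0r).
Qed.

Lemma expansion_term_bound : exists C : R, forall l m,
  modulus (expansion_term l m) <= C * 4^-1 ^+ m.
Proof.
have A0 := sphere_area_gt0 R D.
have [C0 [Q [C00 Q0 HZ]]] := zonal_le D w.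
(* It collects the growth of kappa^m and of the zonal polynomial; the factor 4 provides the decay
   4^-m. *)
pose P : R := 4 * (modulus kappa * (1 + Q)).
have P0 : 0 <= P by rewrite !mulr_ge0 ?modulus_ge0 ?addr_ge0.
have eP : entire (fun m => P ^+ m / m`!%:R : R).
  apply: (@entire_fact _ _ 1 P) => // m.
  by rewrite mul1r ger0_norm// divr_ge0 ?exprn_ge0.
have [C1 C10 HC1] := @pairing_entire_bounded R d f _ _ (@real_smooth_dotxx R d) eP.
pose B := C0 * (area^-1 * (K * 2 ^+ D)).
have HA : 0 <= area^-1 by rewrite invr_ge0 ltW.
have HK : 0 <= K * 2 ^+ D by apply: mulr_ge0; [exact: bessel_const2_ge0|exact: exprn_ge0].
have B0 : 0 <= B by rewrite mulr_ge0// mulr_ge0.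
exists (B * C1) => l m; have [ml|lm] := ltnP m l.
  rewrite expansion_term_triangular// -[0]/(0%:C) modulus_real normr0.
  apply: mulr_ge0; first exact: mulr_ge0.
  by apply: exprn_ge0; rewrite invr_ge0.
have -> : modulus (expansion_term l m) = modulus (zonal d l (1 - w)) *
    (area^-1 * (modulus (sigma_coef l m) * modulus (moment m))).
  by rewrite modulusM; congr (_ * _); rewrite modulusM modulus_real (ger0_norm HA) modulusM.
(* Growth in l becomes growth in m by l <= m; adding 1 makes the powers of the base
   nondecreasing. *)
have HQ : modulus (zonal d l (1 - w)) <= C0 * (1 + Q) ^+ m.
  apply: le_trans (HZ l) _; rewrite ler_wpM2l//.
  apply: (@le_trans _ _ ((1 + Q) ^+ l)); first by rewrite lerXn2r ?nnegrE ?addr_ge0// lerDr.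
  by rewrite ler_weXn2l// lerDl.
have HM := ler_wpM2r (modulus_ge0 (moment m)) (sigma_coef_le l m).
have := ler_pM (modulus_ge0 _) (mulr_ge0 HA (mulr_ge0 (modulus_ge0 _) (modulus_ge0 _))) HQ (ler_wpM2l HA HM).
move/le_trans; apply.
have HC := HC1 m; rewrite ger0_norm in HC; last by rewrite divr_ge0 ?exprn_ge0.
have q0 : 0 <= 4^-1 :> R by rewrite invr_ge0.
have HBC := ler_wpM2r (exprn_ge0 m q0) (ler_wpM2l B0 HC).
apply: le_trans HBC.
rewrite le_eqVlt; apply/orP; left; apply/eqP.
rewrite /P /B -/(moment m); move: K => k; rewrite exprVn !exprMn.
have : 4 ^+ m != 0 :> R by rewrite expf_neq0.
move: (modulus (moment m)) (modulus kappa ^+ m) ((1 + Q) ^+ m) (m`!%:R^-1) (area^-1) (2 ^+ D : R) (4 ^+ m).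
by move=> *; field.
Qed.

Definition fourier_term m : R[i]^o :=
  ((-1) ^+ m * (enorm xi ^+ 2) ^+ m / (4 ^+ m * m`!%:R * poch h m))%:C * moment m.

(** Column m carries kappa^m and powers w^i with i <= m, of which only i = m survives. As kappa w =
    |xi|^2 / 2, the result does not depend on kappa. *)
Lemma expansion_column (hkappa : kappa != 0) m :
  ((2 * pi) ^+ d)%:C * (\sum_(l < m.+1) expansion_term l m) = fourier_term m.
Proof.
have A0 : area != 0 by rewrite gt_eqF// sphere_area_gt0.
transitivity (((2 * pi) ^+ d * (K / area ^+ 2))%:C * (kappa ^+ m * moment m) *
  \sum_(i < m.+1) (\sum_(l < m.+1) square_coef R D m l * (N l)%:R * legendre_coef R D l i)%:C * w ^+ i).
  have -> : \sum_(i < m.+1) (\sum_(l < m.+1) square_coef R D m l * (N l)%:R * legendre_coef R D l i)%:C * w ^+ i =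
    \sum_(l < m.+1) \sum_(i < m.+1) (square_coef R D m l * (N l)%:R * legendre_coef R D l i)%:C * w ^+ i.
    by rewrite exchange_big /=; apply: eq_bigr => i _; rewrite rmorph_sum mulr_suml.
  move: ((2 * pi) ^+ d : R) => c.
  rewrite [(c * _)%:C]rmorphM /= -2![RHS]mulrA; congr (_ * _).
  rewrite !mulr_sumr; apply: eq_bigr => l _.
  have lm : (l <= m)%N by rewrite -ltnS.
  rewrite /expansion_term /sigma_coef /bessel_sqr_coef ltnNge lm /= zonalE.
  (* To exchange the sums, i must range up to m for every l; the coefficients added contain
     ['C(l, i) = 0]. *)
  rewrite [in RHS](bigID (fun i : 'I_m.+1 => i < l.+1)%N) /= [X in _ + X]big1 ?addr0; last first.
    move=> i; rewrite -leqNgt => li.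
    by rewrite /legendre_coef (bin_small li) !(mulr0, mul0r).
  rewrite (big_ord_narrow (n2 := m.+1)) /=.
  rewrite mulr_suml !mulr_sumr; apply: eq_bigr => i _; rewrite /zonal_coef.
  move: K (w ^+ i) (square_coef R D m l) (legendre_coef R D l i) (kappa ^+ m) (moment m).
  move: area A0 => A A0 k wi s p km mu.
  have : (A%:C : R[i]) != 0 by rewrite (inj_eq (@complexI R) _ 0).
  rewrite !rmorphM /= !fmorphV rmorphXn /=.
  by move: (A%:C) => B B0; field.
rewrite sphere_area_const rmorph1 mul1r.
rewrite (eq_bigr (fun i : 'I_m.+1 => if i == m :> nat then
    ((-1) ^+ m * 2 ^+ m / (4 ^+ m * m`!%:R * poch h m))%:C * w ^+ m else 0)); last first.
  move=> i _; rewrite addition_coef ?leq_ord//; last exact: harmonic_dim_bin.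
  by case: eqP => [->|_] //; rewrite mul0r.
rewrite -big_mkcond /= (big_pred1 ord_max) => [|i]; last by [].
have kw : kappa * w = (enorm xi ^+ 2 / 2)%:C.
  move: (enorm xi ^+ 2) => t; rewrite [(t / 2)%:C]rmorphM /= [2^-1%:C]fmorphV rmorph_nat.
  by move: (t%:C) hkappa => u k0; field.
rewrite mulrCA -[X in _ * X = _]mulrA mulrCA -mulrA.
have -> : kappa ^+ m * w ^+ m = ((enorm xi ^+ 2) ^+ m / 2 ^+ m)%:C.
  by rewrite -exprMn kw -expr_div_n; exact/esym/rmorphXn.
rewrite /fourier_term [moment m * _]mulrC [LHS]mulrA; congr (_ * _).
rewrite -[LHS]rmorphM; congr (_%:C).
have n2 : 2 ^+ m != 0 :> R by rewrite expf_neq0.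
move: ((enorm xi ^+ 2) ^+ m) (2 ^+ m : R) n2 ((-1) ^+ m : R) ((4 ^+ m * m`!%:R * poch h m)^-1).
by move=> t u u0 v y; field.
Qed.

Lemma cos_coef_entire : entire (fun n => (~~ odd n)%:R * (-1) ^+ n./2 * (n`!%:R)^-1 : R).
Proof.
apply: (@entire_fact R _ 1 1) => // n.
rewrite mul1r expr1n !normrM normrX normrN1 expr1n mulr1 normfV !normr_nat mul1r.
by case: odd; rewrite /= ?mul0r ?mul1r// invr_ge0.
Qed.

Lemma sin_coef_entire : entire (fun n => (odd n)%:R * (-1) ^+ n.-1./2 * (n`!%:R)^-1 : R).
Proof.
apply: (@entire_fact R _ 1 1) => // n.
rewrite mul1r expr1n !normrM normrX normrN1 expr1n mulr1 normfV !normr_nat mul1r.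
by case: odd; rewrite /= ?mul0r ?mul1r// invr_ge0.
Qed.

Lemma radial_sin (hf : radial f) : f (fun x => (sin (dot xi x))%:C) = 0.
Proof.
have sq := @real_smooth_dot R d xi.
have c := @pairing_pseries R d f _ _ sq sin_coef_entire.
rewrite (_ : f _ = f (fun x => (limn (pseries
  (fun n => (odd n)%:R * (-1) ^+ n.-1./2 * (n`!%:R)^-1) (dot xi x)))%:C)); last by rewrite sinE.
rewrite -(complex_lim c); apply: complex_lim.
refine (complex_cvg_near (N := 0) (@cvg_cst (R[i]^o) 0 nat \oo _) _) => n _.
rewrite /series /= big1_seq// => k _; case ok: (odd k); last by rewrite !mul0r.
by rewrite (radial_moment_odd hf)// mulr0.
Qed.

(** The odd factors of (2k)! cancel the numerators and leave 2^k k!; the denominators amount to 2^k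
    (h)_k. *)
Lemma moment_coef k :
  (\prod_(j < k) (j.*2.+1%:R / (j.*2 + d)%:R)) / (k.*2)`!%:R =
  (4 ^+ k * k`!%:R * poch h k)^-1 :> R.
Proof.
elim: k => [|k IH]; first by rewrite double0 big_ord0 expr0 poch0 !fact0 !mulr1 mul1r.
have f1 : (k.*2)`!%:R != 0 :> R by exact: fact_neq0.
have f2 : k`!%:R != 0 :> R by exact: fact_neq0.
have p0 : poch h k != 0 by rewrite gt_eqF// poch_gt0// divr_gt0.
have y0 : 4 ^+ k != 0 :> R by rewrite expf_neq0.
have x0 : h + k%:R != 0 by rewrite gt_eqF// ltr_wpDr// divr_gt0.
rewrite big_ord_recr /= doubleS !factS !natrM exprS pochS.
have -> : (k.*2 + d)%:R = 2 * (h + k%:R) :> R by rewrite natrD -addnn natrD; field.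
have -> : k.*2.+2%:R = 2 * k.+1%:R :> R by rewrite -natrM mul2n doubleS.
have k1 : k.*2.+1%:R != 0 :> R by rewrite pnatr_eq0.
have k2 : k.+1%:R != 0 :> R by rewrite pnatr_eq0.
transitivity ((4 ^+ k * k`!%:R * poch h k)^-1 * (4 * k.+1%:R * (h + k%:R))^-1).
  rewrite -IH; move: (\prod_(_ < _) _) ((k.*2)`!%:R : R) f1 (h + k%:R) x0 (k.*2.+1%:R : R) k1 (k.+1%:R : R) k2.
  by move=> P F F0 X X0 Y Y0 Z Z0; field; rewrite X0 Z0 F0 Y0.
move: (4 ^+ k) y0 (k`!%:R : R) f2 (poch h k) p0 (h + k%:R) x0 (k.+1%:R : R) k2.
by move=> ? z1 ? z2 ? z3 ? z4 ? z5; field; rewrite z1 z2 z3 z4 z5.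
Qed.

Lemma fourier_series (hf : radial f) : series fourier_term @ \oo --> (fourier f xi : R[i]^o).
Proof.
have sq := @real_smooth_dot R d xi.
have sc : real_smooth (fun x : 'rV[R]_d => cos (dot xi x)).
  by rewrite cosE; exact: (real_smooth_pseries sq cos_coef_entire).
have ss : real_smooth (fun x : 'rV[R]_d => sin (dot xi x)).
  by rewrite sinE; exact: (real_smooth_pseries sq sin_coef_entire).
have sns := real_smoothM (real_smooth_cst (-1)) ss.
have -> : fourier f xi = f (fun x => (cos (dot xi x))%:C).
  rewrite /fourier (_ : f _ = f (fun x => cos (dot xi x) +i* (-1 * sin (dot xi x)))).
    rewrite (pairing_complex f sc sns) (pairing_realZ f (-1) ss) radial_sin//.
    by rewrite !mulr0 addr0.
  by congr (pairing f _); apply/funext => x; rewrite mulN1r.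
have c := @pairing_pseries R d f _ _ sq cos_coef_entire.
rewrite (_ : f _ = f (fun x => (limn (pseries
  (fun n => (~~ odd n)%:R * (-1) ^+ n./2 * (n`!%:R)^-1) (dot xi x)))%:C)); last by rewrite cosE.
move/cvgn_modulusP in c; apply/cvgn_modulusP => e /c[M HM].
(* The cosine series is indexed by all powers, with zero odd coefficients, so its partial sum of
   length 2n is the one of length n here. *)
exists M => n Mn; rewrite (_ : series fourier_term n = series (fun k => ((~~ odd k)%:R * (-1) ^+ k./2 * (k`!%:R)^-1)%:C *
   f (fun x => (dot xi x ^+ k)%:C) : R[i]^o) n.*2).
  by apply: HM; rewrite (leq_trans Mn)// -addnn leq_addr.
elim: n {Mn} => [|n IH]; first by rewrite /series /= !big_nil.
rewrite doubleS /series /= !big_nat_recr//= [X in X + _](IH) -addrA; congr (_ + _).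
rewrite odd_double /= [X in _ = _ + X](_ : _ = 0) ?addr0; last by rewrite !mul0r.
rewrite (radial_moment_even hf)// doubleK mul1r /fourier_term mulrA -rmorphM.
congr (_%:C * _); rewrite -mul2n exprM.
by rewrite mul2n [LHS]mulrAC -[in LHS]mulrA -moment_coef; move: (\prod_(_ < _) _) => P; ring.
Qed.

End Point.
End Expansion.

Theorem theorem3p1 (R : realType) (d : nat) (hd : (2 <= d)%N)
    (f : compact_distribution R d) (hf : radial f)
    (kappa : R[i]) (hkappa : kappa != 0) (xi : 'rV[R]_d) :
  let a : nat -> R[i]^o := fun l =>
    sigma f kappa l * zonal d l (1 - (enorm xi ^+ 2)%:C / (2 * kappa)) in
  [/\ cvgn [normed series a],
      cvgn (series a) &
      fourier f xi = ((2 * pi) ^+ d)%:C * (limn (series a) : R[i])].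
Proof.
case: d hd f hf xi => [|[|D]] // _ f hf xi a.
have [C HC] := expansion_term_bound f kappa xi.
have ht := @expansion_term_triangular R D f kappa xi.
have aE : a = (fun l => limn (series (expansion_term f kappa xi l))).
  by apply/funext => l; rewrite expansion_row.
have cs := triangular_series HC ht.
split.
- by rewrite aE; exact: triangular_normed_series HC ht.
- by rewrite aE; apply/cvg_ex; eexists; exact: cs.
rewrite aE (complex_lim cs) -(complex_lim (fourier_series hf)).
have cc : cvgn (series (fun m => \sum_(l < m.+1) expansion_term f kappa xi l m : R[i]^o)).
  by apply: (@complex_geometric_cvg _ _ C) => m; exact: (triangular_col_bound HC).
apply: complex_lim.
refine (complex_cvg_near (N := 0) (complex_cvgMc (x := ((2 * pi) ^+ D.+2)%:C) cc) _) => n _.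
rewrite /series /= mulr_sumr; apply: eq_bigr => m _.
by rewrite expansion_column.
Qed.
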